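(* Consider the Gaussian partial information model with $N$ forecasters under the compound symmetric information structure with parameters $\delta$ and $\lambda$, with forecasts $p_1,\dots,p_N$, revealed aggregator $p_{cs}''$ and average-probit aggregator $p_{\mathrm{probit}}$, all as described in the context. Then: (i) The probit extremization ratio between $p_{cs}''$ and $p_{\mathrm{probit}}$ is given by the non-random quantity $$\alpha(p_{cs}'',p_{\mathrm{probit}})=\frac{\gamma\sqrt{1-\delta}}{\sqrt{1-\delta\gamma}},\qquad\text{where }\gamma=\frac{N}{(N-1)\lambda+1};$$ (ii) $p_{cs}''$ extremizes $p_{\mathrm{probit}}$ as long as $p_i\neq p_j$ for some $i\neq j$; and (iii) $p_{cs}''$ can leave the convex hull of the individual probability forecasts $p_1,\dots,p_N$.
   Context: Notation: $|\cdot|$ is Lebesgue measure on $S=[0,1]$, and $\Phi$ is the standard normal CDF. Gaussian partial information model: on a probability space $(\Omega,\mathcal{F},\mathbb{P})$ let $\{X_B\}$ be a centered Gaussian process indexed by the Borel subsets $B\subseteq S$ with $\mathrm{Cov}(X_B,X_{B'})=|B\cap B'|$. The target event is $A=\{X_S>0\}$. Forecaster $i$ ($i=1,\dots,N$) has a Borel information set $B_i\subseteq S$ and reports $p_i=\mathbb{E}(\mathbf{1}_A\mid\sigma(X_{B_i}))=\Phi\big(X_{B_i}/\sqrt{1-|B_i|}\big)$. Compound symmetric information structure: $|B_i|=\delta$ for all $i$ and $|B_i\cap B_j|=\lambda\delta$ for all $i\ne j$, so that $(X_{B_1},\dots,X_{B_N})$ has covariance matrix $\Sigma_{22}=(\delta-\lambda\delta)I_N+\lambda\delta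 J_N$, where $I_N$ is the identity matrix and $J_N$ is the $N\times N$ matrix of ones. This structure is coherent (i.e. realizable by Borel sets $B_1,\dots,B_N\subseteq[0,1]$) if and only if $\delta\in[0,1]$ and $\lambda\in\big[\max\{\frac{N-\delta^{-1}}{N-1},0\},1\big]$. Revealed aggregator: in general it is $\mathbb{E}(\mathbf{1}_A\mid\sigma(p_1,\dots,p_N))$. Its expression by Gaussian conditioning is given for coherent $\Sigma_{22}$ such that $\Sigma_{22}^{-1}$ exists. Under the compound symmetric structure it takes the form $$p_{cs}''=\Phi\left(\frac{\frac{1}{(N-1)\lambda+1}\sum_{i=1}^N X_{B_i}}{\sqrt{1-\frac{N\delta}{(N-1)\lambda+1}}}\right),\qquad X_{B_i}=\Phi^{-1}(p_i)\sqrt{1-\delta}.$$ Average-probit aggregator: $p_{\mathrm{probit}}=\Phi\big(\frac1N\sum_{i=1}^N\Phi^{-1}(p_i)\big)$. Probit extremization ratio: $\alpha(q,p)=\Phi^{-1}(q)/\Phi^{-1}(p)$. Extremizing: a probability $p$ is said to be extremized by a probability $q$ if and only if $q$ is closer to zero when $p\le 1/2$ and closer to one when $p\ge 1/2$; in terms of probit scores, $q$ extremizes $p$ if and only if $\Phi^{-1}(q)$ is on the same side of zero as, but further away from zero than, $\Phi^{-1}(p)$. *)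

(* Defs.v *)
From HB Require Import structures.
From mathcomp Require Import all_boot all_order all_algebra.
From mathcomp Require Import all_classical all_reals all_analysis.

Set Implicit Arguments.
Unset Strict Implicit.
Unset Printing Implicit Defensive.

Import Order.TTheory GRing.Theory Num.Theory.
Import numFieldNormedType.Exports.

Local Open Scope classical_set_scope.
Local Open Scope ring_scope.

Section StandardNormal.
Context {R : realType}.

Definition Phi (x : R) : R := fine (normal_prob 0 1 `]-oo, x]).

(* Phi is a bijection from R onto ]0, 1[; outside ]0, 1[ the value is 0. *)
Definition probit (u : R) : R := xget 0 [set x | Phi x = u].

(* alpha(q, p). Since x / 0 = 0, an equality alpha(q, p) = r with r != 0
   implies that neither probit q nor probit p is 0. *)
Definition probit_ratio (q p : R) : R := probit q / probit p.

(* q extremizes p. No q extremizes p = 1/2. *)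
Definition extremizes (q p : R) : Prop :=
  (p <= 1 / 2 -> `|q| < `|p|) /\ (1 / 2 <= p -> `|1 - q| < `|1 - p|).

Definition average_probit (N : nat) (p : 'I_N -> R) : R :=
  Phi (N%:R^-1 * \sum_(i < N) probit (p i)).

Definition conv_hull (N : nat) (p : 'I_N -> R) : set R :=
  [set x | exists w : 'I_N -> R,
    [/\ forall i, 0 <= w i, \sum_(i < N) w i = 1
      & x = \sum_(i < N) w i * p i]].

End StandardNormal.

Section Probability.
Context {d : measure_display} {T : measurableType d} {R : realType}.
Variable P : probability T R.

(* normal_prob m 0 is the uniform law on [0, 1] in the library, hence the
   explicit Dirac mass for the degenerate Gaussian law. *)
Definition gaussian_law (Y : T -> R) : Prop :=
  exists m s : R, forall A : set (measurableTypeR R), measurable A ->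
    P (Y @^-1` A) = if s == 0 then \d_m A else normal_prob m s A.

Definition unit_S : set (measurableTypeR R) := [set` `[0, 1]%R].

Definition borel_subset_S (B : set (measurableTypeR R)) : Prop :=
  measurable B /\ B `<=` unit_S.

(* X is only constrained at the Borel subsets of S = [0, 1]. *)
Record gaussian_information_model
    (X : set (measurableTypeR R) -> {RV P >-> R}) : Prop := {
  gim_gaussian : forall (n : nat) (B : 'I_n -> set (measurableTypeR R))
      (c : 'I_n -> R), (forall k, borel_subset_S (B k)) ->
    gaussian_law (fun w => \sum_(k < n) c k * X (B k) w);
  gim_centered : forall B, borel_subset_S B -> ('E_P[X B] = 0)%E;
  gim_covariance : forall B B', borel_subset_S B -> borel_subset_S B' ->
    covariance P (X B) (X B') = lebesgue_measure (B `&` B') }.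

(* g is a version of E(f | G), for G a sub-sigma-algebra and f integrable. *)
Record is_cond_expectation (f : T -> R) (G : set (set T)) (g : T -> R)
  : Prop := {
  ce_measurable : forall D : set (measurableTypeR R), measurable D ->
    G (g @^-1` D);
  ce_integrable : P.-integrable setT (EFin \o g);
  ce_integral : forall C, G C ->
    (\int[P]_(w in C) (g w)%:E = \int[P]_(w in C) (f w)%:E)%E }.

Definition target_event (X : set (measurableTypeR R) -> {RV P >-> R}) : set T :=
  [set w | 0 < X unit_S w].

Definition is_forecast (X : set (measurableTypeR R) -> {RV P >-> R})
    (B : set (measurableTypeR R)) (p : T -> R) : Prop :=
  is_cond_expectation \1_(target_event X) (g_sigma_algebra_preimage (X B)) p.

Definition is_revealed_aggregator (N : nat)
    (X : set (measurableTypeR R) -> {RV P >-> R})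
    (p : 'I_N -> T -> R) (q : T -> R) : Prop :=
  is_cond_expectation \1_(target_event X) (g_sigma_preimage p) q.

End Probability.

Definition compound_symmetric {R : realType} (N : nat) (delta lambda : R)
    (B : 'I_N -> set (measurableTypeR R)) : Prop :=
  [/\ forall i, borel_subset_S (B i),
      forall i, lebesgue_measure (B i) = delta%:E
    & forall i j, i != j -> lebesgue_measure (B i `&` B j) = (lambda * delta)%:E].

Definition cs_gamma {R : realType} (N : nat) (lambda : R) : R :=
  N%:R / ((N%:R - 1) * lambda + 1).

(* Main.v *)
Require Import Defs.
From HB Require Import structures.
From mathcomp Require Import all_boot all_order all_algebra.
From mathcomp Require Import all_classical all_reals all_analysis.
From mathcomp Require Import measurable_realfun ring lra.
Import Order.TTheory GRing.Theory Num.Theory.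
Import numFieldNormedType.Exports.
Set Implicit Arguments.
Unset Strict Implicit.
Unset Printing Implicit Defensive.
Local Open Scope classical_set_scope.
Local Open Scope ring_scope.

(** Put S = [X unit_S], Y_i = [X (B i)], gamma = [cs_gamma N lambda], M the mean
    of the Y_i and W = S - gamma M.  Every linear combination of the X_B is
    Gaussian, and W is uncorrelated with every Y_i, so W is independent of
    sigma(Y_1, ..., Y_N); since Var W = 1 - delta gamma, conditioning S = gamma M + W
    gives E(1_A | Y_1, ..., Y_N) = Phi(gamma M / sqrt(1 - delta gamma)), and
    E(1_A | Y_i) = Phi(Y_i / sqrt(1 - delta)) in the same way.  The sigma-algebras
    of the p_i and of the Y_i agree up to null sets because Phi is injective, so
    this identifies the revealed aggregator.  The ratio of probits is therefore
    constant; it exceeds 1 exactly when gamma > 1, which fails only if all the Y_i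
    coincide almost surely.  For the convex hull, M is independent of
    (Y_i - M)_i, so M is, with positive probability, large compared with all the
    deviations Y_i - M, and then the aggregator exceeds every p_i.

    Independence of jointly Gaussian variables comes from their characteristic
    functions.  To stay with real functions, the latter are encoded by the
    integrals of cos (t V + theta) for all t and all phases theta: these
    functions are closed under products up to linear combinations, which lets the
    coordinates of a vector be treated one at a time.  *)

(** * Moments and characteristic function of the normal law *)

(** The constant gamma comes from symmetry: Cov(M, Y_j) is the same number delta / gamma for every
    j, whereas Cov(S, Y_j) = |B_j| = delta, so gamma M is the orthogonal projection of S on the span
    of the Y_i. Since only this projection is used and no covariance matrix is inverted, singular
    structures such as lambda = 1 are covered as well.

    Fourier uniqueness is stated for a bounded signed weight G and not for two laws: if G cos (t V +
    theta) always integrates to zero, then G integrates to zero over every event of sigma(V).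
    Independence then follows by suitable choices of G, without constructing joint characteristic
    functions. The one-variable statement rests on Gaussian smoothing: a normal density is itself a
    normal mixture of cosines.

    Forecasts and aggregator are arbitrary versions of conditional expectations, so they are known
    in terms of the Y_i only almost surely, while measurability with respect to sigma(p_1, ..., p_N)
    has to hold exactly. *)

Section WholeLine.
Context {R : realType}.
Notation mu := (@lebesgue_measure R).

(** The decay bound makes F at m + (n + 1) and m - (n + 1) at most C / (n + 1) in absolute value, so
    the integrals of f over these growing intervals tend to 0; dominated convergence identifies
    their limit with the full integral. *)
Lemma integral_derivative_eq0 (F f : R -> R) (m C : R) :
  (forall x : R, is_derive x (1 : R) F (f x)) -> continuous f ->
  mu.-integrable setT (EFin \o f) ->
  (forall x, `|F x| * `|x - m| <= C) ->
  \int[mu]_x f x = 0.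
Proof.
move=> dF cf intf bF.
pose D n := `[m - n.+1%:R, m + n.+1%:R]%classic : set R.
have cvF : (fun n => (F (m + n.+1%:R) - F (m - n.+1%:R)))%R @ \oo --> (0 : R).
  have bnd n : `|F (m + n.+1%:R) - F (m - n.+1%:R)| <= (2 * C) * harmonic n.
    have h e : `|e| = n.+1%:R -> `|F (m + e)| <= C * harmonic n.
      move=> en; have := bF (m + e).
      rewrite (_ : m + e - m = e); last by rewrite addrAC subrr add0r.
      by rewrite en -ler_pdivlMr.
    have h1 := h n.+1%:R (ger0_norm (ler0n _ _)).
    have h2 := h (- n.+1%:R); rewrite normrN in h2.
    have {}h2 := h2 (ger0_norm (ler0n _ _)).
    rewrite (le_trans (ler_normB _ _))//.
    by rewrite -mulrA mulr_natl mulr2n lerD.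
  apply: norm_cvg0.
  apply: (@squeeze_cvgr _ _ _ _ (cst 0) (fun n => 2 * C * harmonic n)).
  - by apply: nearW => n; rewrite normr_ge0 bnd.
  - exact: cvg_cst.
  - rewrite -[X in _ --> X](mulr0 (2 * C)); apply: cvgMr; exact: cvg_harmonic.
have iD n : \int[mu]_(x in D n) f x = F (m + n.+1%:R) - F (m - n.+1%:R).
  rewrite /Rintegral (@continuous_FTC2 _ f F) //=.
  - by rewrite ltrD2l -subr_gt0 opprK addr_gt0.
  - exact: continuous_subspaceT.
  - have cF : continuous F.
      by move=> x; apply/differentiable_continuous/derivable1_diffP; have [] := dF x.
    split; [by move=> x _; have [] := dF x| |].
    + exact/cvg_at_right_filter/cF.
    + exact/cvg_at_left_filter/cF.
  - by move=> x _; rewrite derive1E; have [_ ->] := dF x.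
have mD n : measurable (D n) by exact: measurable_itv.
have mf : measurable_fun [set: R] f by apply/measurable_EFinP; exact: measurable_int intf.
have mfD n : measurable_fun [set: R] (f \_ (D n)).
  by apply/(measurable_restrictT f (mD n)); exact: measurable_funTS.
have := @dominated_convergence _ _ _ mu setT measurableT
  (fun n => EFin \o (f \_ (D n))) (EFin \o f) (fun x => `|f x|%:E).
case.
- by move=> n; apply/measurable_EFinP; exact: mfD.
- exact/measurable_EFinP.
- apply: aeW => x _; apply: cvg_near_cst.
  exists (Num.trunc `|x - m|) => // n /= nx.
  rewrite patchE ifT// inE /D /= in_itv/=.
  have xn : `|x - m| < n.+1%:R.
    by rewrite (lt_le_trans (truncnS_gt _))// ler_nat ltnS.
  have := ltW xn; rewrite ler_distl => /andP[-> ->] //.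
- exact: (integrable_norm intf).
- apply: aeW => x n _; rewrite lee_fin patchE; case: ifP => // _.
  by rewrite normr0.
move=> _ _ cv.
have : (fun n => (F (m + n.+1%:R) - F (m - n.+1%:R))%:E) @ \oo -->
    (\int[mu]_x (f x)%:E)%E.
  apply: cvg_trans cv; apply: near_eq_cvg; apply: nearW => n /=.
  rewrite -iD /Rintegral fineK.
    by rewrite [in RHS]integral_mkcond restrict_EFin.
  apply: integrable_fin_num; first exact: mD.
  exact: (@integrableS _ _ _ mu _ _ _ measurableT (mD n) (@subsetT _ _) intf).
rewrite -(fineK (integrable_fin_num measurableT intf)) => /fine_cvg h.
exact: (cvg_unique _ h cvF).
Qed.

End WholeLine.

Section NormalIntegral.
Context {R : realType}.
Notation mu := (@lebesgue_measure R).
Variables m s : R.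

(** The Radon-Nikodym derivative of [normal_prob m s] agrees almost everywhere with
    [normal_pdf m s], because both integrate to the same value over every measurable set. *)
Lemma ge0_integral_normal_prob (f : R -> \bar R) : measurable_fun [set: R] f ->
  (forall x, 0 <= f x)%E ->
  (\int[normal_prob m s]_x f x = \int[mu]_x (f x * (normal_pdf m s x)%:E))%E.
Proof.
move=> mf f0.
rewrite -(@Radon_Nikodym_SigmaFinite.change_of_variables _ _ _ _ mu)//.
- apply: ae_eq_integral => //.
  + apply: emeasurable_funM => //.
    exact: measurable_int (Radon_Nikodym_SigmaFinite.f_integrable (normal_prob_dominates m s)).
  + apply: emeasurable_funM => //.
    by apply/measurable_EFinP; exact: measurable_normal_pdf.
  + apply: ae_eqe_mul2l.
    apply: integral_ae_eq => //.
    * exact: Radon_Nikodym_SigmaFinite.f_integrable (normal_prob_dominates m s).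
    * by apply/measurable_EFinP; exact: measurable_normal_pdf.
    * move=> E _ mE.
      by rewrite -Radon_Nikodym_SigmaFinite.f_integral//; exact: normal_prob_dominates.
- exact: normal_prob_dominates.
Qed.

Lemma normal_prob_integrable (f : R -> R) : measurable_fun [set: R] f ->
  mu.-integrable setT (fun x => (f x * normal_pdf m s x)%:E) ->
  (normal_prob m s).-integrable setT (EFin \o f).
Proof.
move=> mf /integrableP[_ h]; apply/integrableP; split; first exact/measurable_EFinP.
rewrite ge0_integral_normal_prob//; last first.
  by apply: measurableT_comp => //; exact/measurable_EFinP.
rewrite (le_lt_trans _ h)// le_eqVlt; apply/orP; left; apply/eqP.
apply: eq_integral => x _ /=.
by rewrite -EFinM normrM (ger0_norm (normal_pdf_ge0 _ _ _)).
Qed.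

Lemma Rintegral_normal_prob (f : R -> R) : measurable_fun [set: R] f ->
  mu.-integrable setT (fun x => (f x * normal_pdf m s x)%:E) ->
  \int[normal_prob m s]_x f x = \int[mu]_x (f x * normal_pdf m s x).
Proof.
move=> mf intf; rewrite /Rintegral; congr fine.
rewrite [LHS]integralE [RHS]integralE.
rewrite !ge0_integral_normal_prob//; last 2 first.
  by apply: measurable_funeneg; exact/measurable_EFinP.
  by apply: measurable_funepos; exact/measurable_EFinP.
congr (_ - _)%E; apply: eq_integral => x _.
  rewrite !funeposE -!EFin_max -EFinM maxr_pMl ?normal_pdf_ge0//.
  by rewrite mul0r.
rewrite !funenegE -!EFinN -!EFin_max -EFinM maxr_pMl ?normal_pdf_ge0//.
by rewrite mul0r mulNr.
Qed.
End NormalIntegral.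

Section NormalMoments.
Context {R : realType}.
Notation mu := (@lebesgue_measure R).
Variables m s : R.
Hypothesis s0 : s != 0.

Lemma is_derive_normal_pdf (x : R) :
  is_derive x (1 : R) (normal_pdf m s) (- (x - m) / s ^+ 2 * normal_pdf m s x).
Proof.
have E : normal_pdf m s = cst (normal_peak s) *
    (expR \o (cst (- (s ^+ 2 *+ 2)^-1) * ((id - cst m) * (id - cst m)))).
  apply/funext => y; rewrite normal_pdfE// /normal_fun /=.
  rewrite !fctE /=; congr (_ * expR _).
  by set k := (_ *+ 2)^-1; ring.
rewrite E.
apply: is_derive_eq.
rewrite /GRing.scale /= !fctE /=.
by field.
Qed.

(** With u = (x - m)^2 / (4 s^2) the density is a multiple of exp(-u) exp(-u). One factor absorbs
    the square, since u exp(-u) <= 1; the other is, up to a constant, the normal density of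
    deviation sqrt(2) s. *)
Lemma sqr_normal_pdf_le (x : R) :
  (x - m) ^+ 2 * normal_pdf m s x <=
  (4 * s ^+ 2 * normal_peak s / normal_peak (Num.sqrt 2 * s)) *
  normal_pdf m (Num.sqrt 2 * s) x.
Proof.
have r2 : Num.sqrt 2 != 0 :> R by rewrite gt_eqF// sqrtr_gt0.
have t0 : Num.sqrt 2 * s != 0 by rewrite mulf_neq0.
have pk : normal_peak (Num.sqrt 2 * s) != 0 by rewrite gt_eqF// normal_peak_gt0.
have s2 : 0 < s ^+ 2 by rewrite exprn_even_gt0.
pose u := (x - m) ^+ 2 / (4 * s ^+ 2).
have E1 : normal_fun m s x = expR (- u) * expR (- u).
  by rewrite -expRD /normal_fun; congr expR; rewrite /u; field.
have E2 : normal_fun m (Num.sqrt 2 * s) x = expR (- u).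
  rewrite /normal_fun; congr expR; rewrite /u exprMn sqr_sqrtr//.
  by field.
have E3 : (x - m) ^+ 2 = 4 * s ^+ 2 * u by rewrite /u; field.
have -> : normal_pdf m s x = normal_peak s * (expR (- u) * expR (- u)).
  by rewrite normal_pdfE// E1.
have -> : normal_pdf m (Num.sqrt 2 * s) x = normal_peak (Num.sqrt 2 * s) * expR (- u).
  by rewrite normal_pdfE// E2.
rewrite [leRHS](_ : _ = (4 * s ^+ 2 * normal_peak s) * expR (- u)); last by field.
rewrite E3 [leLHS](_ : _ = (4 * s ^+ 2 * normal_peak s) * (u * (expR (- u) * expR (- u)))); last by ring.
rewrite ler_pM2l; last by rewrite mulr_gt0 ?normal_peak_gt0// mulr_gt0.
rewrite mulrA ler_piMl ?expR_ge0// expRN ler_pdivrMr ?expR_gt0// mul1r.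
by rewrite (le_trans _ (expR_ge1Dx _))// lerDr.
Qed.

Lemma integrable_sqr_normal_pdf :
  mu.-integrable setT (fun x => ((1 + (x - m) ^+ 2) * normal_pdf m s x)%:E).
Proof.
under eq_fun do rewrite mulrDl mul1r EFinD.
apply: integrableD => //; first exact: integrable_normal_pdf.
pose C := (4 * s ^+ 2 * normal_peak s / normal_peak (Num.sqrt 2 * s)).
apply: (@le_integrable _ _ _ mu _ measurableT _ (fun x => C%:E * (normal_pdf m (Num.sqrt 2 * s) x)%:E)%E).
- apply/measurable_EFinP; apply: measurable_funM; last exact: measurable_normal_pdf.
  by apply: measurable_funX; exact: measurable_funB.
- move=> x _; rewrite -EFinM !abse_EFin lee_fin ger0_norm.
    by rewrite (le_trans (sqr_normal_pdf_le x))// ler_norm.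
  by rewrite mulr_ge0// ?sqr_ge0// normal_pdf_ge0.
- by apply: integrableZl => //; exact: integrable_normal_pdf.
Qed.

(** Supplies the decay at infinity required by [integral_derivative_eq0] in [normal_stein]. *)
Lemma normal_pdf_quadratic_bound :
  exists C : R, forall x, (1 + (x - m) ^+ 2) * normal_pdf m s x <= C.
Proof.
have r2 : Num.sqrt 2 != 0 :> R by rewrite gt_eqF// sqrtr_gt0.
have t0 : Num.sqrt 2 * s != 0 by rewrite mulf_neq0.
exists (normal_peak s + 4 * s ^+ 2 * normal_peak s / normal_peak (Num.sqrt 2 * s) * normal_peak (Num.sqrt 2 * s)) => x.
rewrite mulrDl mul1r lerD//; first exact: normal_pdf_ub.
rewrite (le_trans (sqr_normal_pdf_le x))// ler_wpM2l ?normal_pdf_ub//.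
by rewrite divr_ge0 ?normal_peak_ge0// mulr_ge0 ?normal_peak_ge0// mulr_ge0// sqr_ge0.
Qed.

End NormalMoments.

Lemma Rintegral_probability_cst d (T : measurableType d) (R : realType)
  (P : probability T R) (c : R) : \int[P]_x c = c.
Proof.
rewrite Rintegral_cst// -[RHS]mulr1; congr (_ * _).
exact: (congr1 fine (probability_setT P)).
Qed.

Lemma ler_norm_1Dsqr {R : realType} (x : R) : `|x| <= 1 + x ^+ 2.
Proof. by case: (ler0P x) => h; nra. Qed.

(** * Stein's identity and the first two moments *)

Section Stein.
Context {R : realType}.
Notation mu := (@lebesgue_measure R).
Variables m s : R.
Hypothesis s0 : s != 0.
Notation N := (normal_prob m s).

Lemma normal_integrable_mulpdf (h : R -> R) (K : R) : measurable_fun [set: R] h ->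
  (forall x, `|h x| <= K * (1 + (x - m) ^+ 2)) ->
  mu.-integrable setT (fun x => (h x * normal_pdf m s x)%:E).
Proof.
move=> mh hK.
apply: (@le_integrable _ _ _ mu _ measurableT _
  (fun x => K%:E * ((1 + (x - m) ^+ 2) * normal_pdf m s x)%:E)%E).
- apply/measurable_EFinP; apply: measurable_funM => //.
  exact: measurable_normal_pdf.
- move=> x _; rewrite -EFinM !abse_EFin lee_fin /= [leLHS]normrM.
  rewrite (ger0_norm (normal_pdf_ge0 _ _ _)) mulrA.
  rewrite (le_trans _ (ler_norm _))// ler_wpM2r//; exact: normal_pdf_ge0.
- by apply: integrableZl => //; exact: integrable_sqr_normal_pdf.
Qed.

Lemma normal_integrable (h : R -> R) (K : R) : measurable_fun [set: R] h ->
  (forall x, `|h x| <= K * (1 + (x - m) ^+ 2)) ->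
  N.-integrable setT (EFin \o h).
Proof.
move=> mh hK; apply: normal_prob_integrable => //.
exact: normal_integrable_mulpdf hK.
Qed.

(** Integration by parts: the derivative of [h * normal_pdf m s] is h' times the density minus s^-2
    h (x - m) times the density, and its integral over the line vanishes. The two growth bounds give
    both integrability and decay. *)
Lemma normal_stein (h h' : R -> R) (K : R) :
  (forall x : R, is_derive x (1 : R) h (h' x)) -> continuous h' ->
  (forall x, `|h' x| <= K * (1 + (x - m) ^+ 2)) ->
  (forall x, `|h x| * `|x - m| <= K * (1 + (x - m) ^+ 2)) ->
  \int[N]_x (h x * (x - m)) = s ^+ 2 * \int[N]_x h' x.
Proof.
move=> dh ch' bh' bh.
have ch : continuous h.
  by move=> x; apply/differentiable_continuous/derivable1_diffP; have [] := dh x.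
have cm : continuous (fun x : R => x - m).
  by move=> x; apply: cvgB; [exact: cvg_id|exact: cvg_cst].
have mh : measurable_fun [set: R] (fun x => h x * (x - m)).
  by apply: continuous_measurable_fun => x; apply: cvgM; [exact: ch|exact: cm].
have mh' : measurable_fun [set: R] h' by exact: continuous_measurable_fun.
have bhm x : `|h x * (x - m)| <= K * (1 + (x - m) ^+ 2) by rewrite normrM.
have i1 := normal_integrable_mulpdf mh bhm.
have i2 := normal_integrable_mulpdf mh' bh'.
have [C hC] := @normal_pdf_quadratic_bound _ m s s0.
have s2 : s ^+ 2 != 0 by rewrite expf_neq0.
pose F x := h x * normal_pdf m s x.
pose f x := h' x * normal_pdf m s x - (s ^+ 2)^-1 * (h x * (x - m) * normal_pdf m s x).
have i3 : mu.-integrable setT (fun x => ((s ^+ 2)^-1)%:E * (h x * (x - m) * normal_pdf m s x)%:E)%E.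
  exact: integrableZl.
have K0 : 0 <= K.
  have := bh m; rewrite subrr normr0 mulr0 expr0n addr0 mulr1; exact.
have : \int[mu]_x f x = 0.
  apply: (@integral_derivative_eq0 _ F f m (K * C)).
  - move=> x; have dp := is_derive_normal_pdf m s0 x.
    have -> : F = h * normal_pdf m s by [].
    have := dh x => dhx.
    by apply: is_derive_eq; rewrite /GRing.scale /= /f; field.
  - move=> x; apply: cvgB.
      by apply: cvgM; [exact: ch'|exact: continuous_normal_pdf].
    apply: cvgM; first exact: cvg_cst.
    apply: cvgM; last exact: continuous_normal_pdf.
    by apply: cvgM; [exact: ch|exact: cm].
  - have -> : EFin \o f = (fun x => (h' x * normal_pdf m s x)%:E -
        ((s ^+ 2)^-1)%:E * (h x * (x - m) * normal_pdf m s x)%:E)%E.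
      by apply/funext => x; rewrite /f /= EFinB EFinM.
    exact: integrableB.
  - move=> x; rewrite /F normrM (ger0_norm (normal_pdf_ge0 _ _ _)) mulrAC.
    rewrite (@le_trans _ _ (K * (1 + (x - m) ^+ 2) * normal_pdf m s x))//.
      by rewrite ler_wpM2r// normal_pdf_ge0.
    by rewrite -mulrA ler_wpM2l.
have i4 : mu.-integrable setT
    (EFin \o (fun x => (s ^+ 2)^-1 * (h x * (x - m) * normal_pdf m s x))).
  by move: i3; congr (_.-integrable _ _); apply/funext => x /=; rewrite EFinM.
rewrite RintegralB//.
rewrite RintegralZl// -!Rintegral_normal_prob// => /eqP.
by rewrite subr_eq0 => /eqP ->; rewrite mulrA divff// mul1r.
Qed.

Lemma normal_centered : \int[N]_x (x - m) = 0.
Proof.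
have := @normal_stein (cst 1) (cst 0) 1.
under eq_Rintegral do rewrite mul1r.
move=> ->.
- by rewrite Rintegral_probability_cst mulr0.
- by move=> x; exact: cvg_cst.
- by move=> x; rewrite normr0 mul1r addr_ge0// sqr_ge0.
- by move=> x; rewrite normr1 !mul1r ler_norm_1Dsqr.
Qed.

Lemma normal_second_moment : \int[N]_x (x - m) ^+ 2 = s ^+ 2.
Proof.
have D (x : R) : is_derive x (1 : R) (fun x => x - m) (cst 1 x).
  have -> : (fun x : R => x - m) = id - cst m by [].
  by apply: is_derive_eq; rewrite subr0.
under eq_Rintegral do rewrite expr2.
rewrite (normal_stein (K := 1) D).
- by rewrite Rintegral_probability_cst mulr1.
- by move=> x; exact: cvg_cst.
- by move=> x; rewrite normr1 mul1r lerDl sqr_ge0.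
- by move=> x; rewrite mul1r -normrM -expr2 ger0_norm ?sqr_ge0// lerDr.
Qed.

End Stein.

(** * Characteristic function of the normal law *)

Section NormalCF.
Context {R : realType}.
Notation mu := (@lebesgue_measure R).
Variables m s : R.
Hypothesis s0 : s != 0.
Notation N := (normal_prob m s).

(** Differentiating under the integral sign and applying Stein's identity to h = sin (t (x - m) +
    theta) gives phi'(t) = - s^2 t phi(t) for the left side phi. Hence phi(t) exp(s^2 t^2 / 2) is
    constant, and its value at t = 0 is cos theta. *)
Lemma normal_cos_shift (t theta : R) :
  \int[N]_x cos (t * (x - m) + theta) = cos theta * expR (- (t * s) ^+ 2 / 2).
Proof.
pose f (t x : R) := cos (t * (x - m) + theta).
pose f' (t x : R) := - (x - m) * sin (t * (x - m) + theta).
have cm : continuous (fun x : R => x - m).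
  by move=> x; apply: cvgB; [exact: cvg_id|exact: cvg_cst].
have ca t' : continuous (fun x : R => t' * (x - m) + theta).
  by move=> x; apply: cvgD; [apply: cvgMr; exact: cm|exact: cvg_cst].
have ccos t' : continuous (f t').
  by move=> x; apply: (continuous_comp (ca t' x)); exact: continuous_cos.
have csin t' : continuous (fun x => sin (t' * (x - m) + theta)).
  by move=> x; apply: (continuous_comp (ca t' x)); exact: continuous_sin.
have le1 := @ler_norm_1Dsqr R.
have ge1 (x : R) : 1 <= 1 + x ^+ 2 by rewrite lerDl sqr_ge0.
have df (t' x : R) : is_derive t' (1 : R) (f ^~ x) (f' t' x).
  have -> : f ^~ x = cos \o (cst (x - m) * id + cst theta).
    by apply/funext => u; rewrite /f /= !fctE /= mulrC.
  apply: is_derive_eq.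
  by rewrite /GRing.scale /= /f' !fctE /= [in RHS](mulrC t'); ring.
have intf t' : N.-integrable setT (EFin \o f t').
  apply: (@normal_integrable _ m s s0 _ 1).
    exact: continuous_measurable_fun.
  by move=> x; rewrite mul1r (le_trans (cos_max _)).
have intG : N.-integrable setT (EFin \o (fun x => `|x - m|)).
  apply: (@normal_integrable _ m s s0 _ 1).
    by apply: continuous_measurable_fun => x; apply: cvg_norm; exact: cm.
  by move=> x; rewrite mul1r normr_id.
have p1E u x : partial1of2 f u x = f' u x.
  by rewrite partial1of2E; have [_ ->] := df u x.
pose phi t' := \int[N]_x f t' x.
have dphi (u : R) : is_derive u (1 : R) phi (- (s ^+ 2 * u) * phi u).
  have Iu : `]u - 1, u + 1[%classic u by rewrite /= in_itv/=; apply/andP; split; lra.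
  have h1 x y : `]u - 1, u + 1[%classic x -> setT y -> derivable (f ^~ y) x 1.
    by move=> _ _; have [] := df x y.
  have h2 x y : `]u - 1, u + 1[%classic x -> setT y ->
      `|partial1of2 f x y| <= `|y - m|.
    move=> _ _; rewrite p1E /f' normrM normrN ler_piMr//.
    by rewrite ler_norml sin_geN1 sin_le1.
  apply: DeriveDef.
    exact: (@derivable_under_integral _ _ _ N f setT measurableT u _ _ Iu
      (fun x _ => intf x) h1 _ (fun y => normr_ge0 _) intG h2).
  rewrite -derive1E.
  rewrite (@differentiation_under_integral _ _ _ N f setT measurableT u _ _ Iu
      (fun x _ => intf x) h1 _ (fun y => normr_ge0 _) intG h2).
  have D (x : R) : is_derive x (1 : R) (fun x => sin (u * (x - m) + theta))
      (u * f u x).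
    have -> : (fun x => sin (u * (x - m) + theta)) =
        sin \o (cst u * (id - cst m) + cst theta) by [].
    by apply: is_derive_eq; rewrite /GRing.scale /= !fctE /= /f; ring.
  transitivity (- \int[N]_x (sin (u * (x - m) + theta) * (x - m))).
    rewrite -mulN1r -RintegralZl//.
      by apply: eq_Rintegral => x _; rewrite p1E /f'; ring.
    apply: (@normal_integrable _ m s s0 _ 1).
      apply: continuous_measurable_fun => x.
      by apply: cvgM; [exact: csin|exact: cm].
    move=> x; rewrite mul1r normrM (le_trans _ (le1 _))// ler_piMl//.
    by rewrite ler_norml sin_geN1 sin_le1.
  rewrite (normal_stein s0 (K := 1 + `|u|) D).
  - by rewrite RintegralZl// -/(phi u); ring.
  - by move=> x; apply: cvgMr; exact: ccos.
  - move=> x; rewrite normrM.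
    have := cos_max (u * (x - m) + theta); have := ge1 (x - m).
    have := normr_ge0 u; have := normr_ge0 (f u x); rewrite /f.
    move: `|u| `|cos _| => a b; nra.
  - move=> x.
    have hs : `|sin (u * (x - m) + theta)| <= 1 by rewrite ler_norml sin_geN1 sin_le1.
    have := le1 (x - m); have := normr_ge0 u; have := normr_ge0 (x - m).
    have := normr_ge0 (sin (u * (x - m) + theta)); move: hs.
    move: `|u| `|x - m| `|sin _| => a b c; nra.
pose psi := phi * (expR \o (cst (s ^+ 2 / 2) * (id * id))).
have psi0 (u v : R) : psi u = psi v.
  apply: is_derive_0_is_cst => x; have dx := dphi x.
  apply: is_derive_eq; rewrite /GRing.scale /= !fctE /=; by field.
have := psi0 t 0; rewrite /psi /= !fctE /= !mulr0 expR0 mulr1 => e.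
have phi00 : phi 0 = cos theta.
  rewrite /phi /f; under eq_Rintegral do rewrite mul0r add0r.
  by rewrite Rintegral_probability_cst.
rewrite phi00 in e.
rewrite -/(phi t) -e -mulrA -expRD -[LHS]mulr1 -expR0; congr (_ * expR _).
by field.
Qed.

Lemma normal_cos (t theta : R) :
  \int[N]_x cos (t * x + theta) = cos (t * m + theta) * expR (- (t * s) ^+ 2 / 2).
Proof.
rewrite -normal_cos_shift; apply: eq_Rintegral => x _.
by congr cos; ring.
Qed.
End NormalCF.

(** * Uniqueness of characteristic functions *)

Section BoundedMeasurable.
Context {d : measure_display} {T : measurableType d} {R : realType}.
Implicit Types f g : T -> R.

(** A class that is stable under sums and products and integrable under every probability measure,
    so that no integrability has to be tracked in the Fourier arguments. *)
Definition bounded_measurable f :=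
  measurable_fun setT f /\ exists M, forall x, `|f x| <= M.

Lemma bounded_measurable_cst (r : R) : bounded_measurable (cst r).
Proof. by split => //; exists `|r|. Qed.

Lemma bounded_measurableN f : bounded_measurable f ->
  bounded_measurable (fun x => - f x).
Proof.
move=> [mf [M hM]]; split; first exact: measurableT_comp.
by exists M => x; rewrite normrN.
Qed.

Lemma bounded_measurableD f g : bounded_measurable f -> bounded_measurable g ->
  bounded_measurable (fun x => f x + g x).
Proof.
move=> [mf [M hM]] [mg [K hK]]; split; first exact: measurable_funD.
by exists (M + K) => x; rewrite (le_trans (ler_normD _ _))// lerD.
Qed.

Lemma bounded_measurableB f g : bounded_measurable f -> bounded_measurable g ->
  bounded_measurable (fun x => f x - g x).
Proof.
by move=> bf bg; apply: bounded_measurableD => //; exact: bounded_measurableN.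
Qed.

Lemma bounded_measurableM f g : bounded_measurable f -> bounded_measurable g ->
  bounded_measurable (fun x => f x * g x).
Proof.
move=> [mf [M hM]] [mg [K hK]]; split; first exact: measurable_funM.
by exists (M * K) => x; rewrite normrM ler_pM.
Qed.

Lemma bounded_measurable_cos f : measurable_fun setT f ->
  bounded_measurable (fun x => cos (f x)).
Proof.
move=> mf; split; last by exists 1 => x; exact: cos_max.
apply: (measurableT_comp _ mf).
by apply: continuous_measurable_fun; exact: continuous_cos.
Qed.

Lemma bounded_measurable_indic (A : set T) : measurable A ->
  bounded_measurable (\1_A : T -> R).
Proof.
move=> mA; split; first exact: measurable_indic.
by exists 1 => x; rewrite indicE ger0_norm// lern1 leq_b1.
Qed.

Variable P : probability T R.

Lemma bounded_measurable_integrable f (A : set T) : measurable A ->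
  bounded_measurable f -> P.-integrable A (EFin \o f).
Proof.
move=> mA [mf [M hM]]; apply: (@integrableS _ _ _ P setT) => //.
apply: measurable_bounded_integrable => //.
  by rewrite (le_lt_trans (probability_le1 P measurableT))// ltry.
exists M; split; first exact: num_real.
by move=> y My x _ /=; rewrite (le_trans (hM x))// ltW.
Qed.

Lemma dynkin_zero_integral f : bounded_measurable f -> \int[P]_x f x = 0 ->
  dynkin [set A | measurable A /\ (\int[P]_(x in A) (f x)%:E = 0)%E].
Proof.
move=> bf f0.
have if0 A : measurable A -> P.-integrable A (EFin \o f).
  by move=> mA; exact: bounded_measurable_integrable.
have {}f0 : (\int[P]_x (f x)%:E = 0)%E.
  rewrite -(fineK (integrable_fin_num measurableT (if0 _ measurableT))).
  by move: f0; rewrite /Rintegral => ->.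
split => /=.
- by [].
- move=> A [mA A0]; split; first exact: measurableC.
  have : (\int[P]_(x in A `|` ~` A) (f x)%:E = 0)%E by rewrite setUv.
  rewrite integral_setU//; last 3 first.
  + exact: measurableC.
  + by rewrite setUv; apply/measurable_EFinP; exact: bf.1.
  + exact/disj_setPCl.
  by rewrite A0 add0e.
- move=> F tF HF; split.
    by apply: bigcupT_measurable => i; have [] := HF i.
  rewrite integral_bigcup//; last 2 first.
  + by move=> i; have [] := HF i.
  + by apply: if0; apply: bigcupT_measurable => i; have [] := HF i.
  by rewrite eseries0// => i _ _; have [] := HF i.
Qed.

(** The pi-lambda theorem; the vanishing of the integral over the whole space is what gives closure
    under complements. *)
Lemma zero_integral_g_sigma f (C : set (set T)) : bounded_measurable f ->
  setI_closed C -> C `<=` measurable -> \int[P]_x f x = 0 ->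
  (forall A, C A -> (\int[P]_(x in A) (f x)%:E = 0)%E) ->
  forall A, <<s C >> A -> (\int[P]_(x in A) (f x)%:E = 0)%E.
Proof.
move=> bf CI Cm f0 Cf A sA.
have := @lambda_system_subset _ _ CI setT _
  ((dynkin_lambda_system _).1 (dynkin_zero_integral bf f0)).
move=> /(_ _ _ _ sA) []// B CB; split; [exact: Cm|exact: Cf].
Qed.

Lemma Rintegral_indicM f (A : set T) : measurable A ->
  \int[P]_x (f x * \1_A x) = \int[P]_(x in A) f x.
Proof.
move=> mA; rewrite [RHS]Rintegral_mkcond; apply: eq_Rintegral => x _.
by rewrite patchE indicE; case: ifPn => // _; rewrite ?mulr1 ?mulr0.
Qed.

End BoundedMeasurable.

Section BoundedFubini.
Context {d1 d2 : measure_display} {T1 : measurableType d1}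
  {T2 : measurableType d2} {R : realType}.
Variables (P1 : probability T1 R) (P2 : probability T2 R).

Lemma bounded_measurable_Fubini (f : T1 * T2 -> R) : bounded_measurable f ->
  \int[P1]_x \int[P2]_y f (x, y) = \int[P2]_y \int[P1]_x f (x, y).
Proof.
move=> bf.
have i2 x : (\int[P2]_y (f (x, y))%:E)%E = (\int[P2]_y f (x, y))%:E.
  rewrite /Rintegral fineK//; apply: integrable_fin_num => //.
  apply: bounded_measurable_integrable => //.
  case: bf => mf [M hM]; split; last by exists M => y; exact: hM.
  exact: measurableT_comp.
have i1 y : (\int[P1]_x (f (x, y))%:E)%E = (\int[P1]_x f (x, y))%:E.
  rewrite /Rintegral fineK//; apply: integrable_fin_num => //.
  apply: bounded_measurable_integrable => //.
  case: bf => mf [M hM]; split; last by exists M => x; exact: hM.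
  exact: measurableT_comp.
transitivity (fine (\int[P1]_x \int[P2]_y (f (x, y))%:E)%E).
  by congr fine; apply: eq_integral => x _; rewrite i2.
rewrite (@Fubini _ _ _ _ _ P1 P2 (EFin \o f)).
  by congr fine; apply: eq_integral => x _; rewrite /= i1.
exact: (@bounded_measurable_integrable _ _ _ (P1 \x P2)%E).
Qed.

End BoundedFubini.

(** Chebyshev's inequality, with s^2 as the variance. *)
Lemma normal_tail {R : realType} (m s eps : R) (A : set R) : s != 0 -> 0 < eps ->
  measurable A -> (forall y, A y -> eps <= `|y - m|) ->
  fine (normal_prob m s A) <= s ^+ 2 / eps ^+ 2.
Proof.
move=> s0 e0 mA hA.
have e2 : 0 < eps ^+ 2 by rewrite exprn_gt0.
have mq : measurable_fun [set: R] (fun y : R => (y - m) ^+ 2).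
  by apply: measurable_funX; exact: measurable_funB.
have iq : (normal_prob m s).-integrable setT (EFin \o (fun y : R => (y - m) ^+ 2)).
  apply: (@normal_integrable _ m s s0 _ 1) => // y.
  by rewrite ger0_norm ?sqr_ge0// mul1r lerDr.
rewrite ler_pdivlMr// mulrC -(normal_second_moment m s0) -lee_fin EFinM.
rewrite fineK; last by apply: fin_num_measure.
rewrite /Rintegral fineK; last exact: integrable_fin_num.
rewrite -integral_cst//.
apply: (@le_trans _ _ (\int[normal_prob m s]_(y in A) ((y - m) ^+ 2)%:E)%E).
  apply: ge0_le_integral => //=.
  - by move=> x _; rewrite lee_fin ltW.
  - by apply/measurable_EFinP; exact: measurable_funTS.
  - move=> x Ax; rewrite lee_fin -(real_normK (num_real (x - m))).
    by rewrite lerXn2r ?nnegrE// ?hA// ltW.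
apply: ge0_subset_integral => //=.
- exact/measurable_EFinP.
- by move=> x _; rewrite lee_fin sqr_ge0.
Qed.

(** Put e = 1 / (n + 1). The deviation is e^2 while the endpoint is moved by e: for v = c an unmoved
    ray would keep mass 1/2, but c - e is 1 / e deviations away from c, so the mass tends to 0, the
    value of the indicator of the open ray. *)
Lemma normal_prob_concentrates {R : realType} (v c : R) :
  (fun n => fine (normal_prob v (n.+1%:R^-1 ^+ 2) `]-oo, c - n.+1%:R^-1[%classic))
    @ \oo --> (\1_(`]-oo, c[%classic) v : R).
Proof.
have e0 n : 0 < n.+1%:R^-1 :> R by rewrite invr_gt0.
have e1 n : n.+1%:R^-1 <= 1 :> R by rewrite invf_le1 // ler1n.
have s0 n : n.+1%:R^-1 ^+ 2 != 0 :> R by rewrite expf_neq0// gt_eqF.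
have cve : (fun n => n.+1%:R^-1 : R) @ \oo --> (0 : R) by exact: cvg_harmonic.
have [vc|cv] := ltP v c.
- rewrite indicE mem_set/=; last by rewrite in_itv.
  (* Half the gap between v and c: once e < h, every point beyond c - e is at distance at least h
     from v. *)
  pose h := (c - v) / 2; have h0 : 0 < h by rewrite divr_gt0// subr_gt0.
  apply/subr_cvg0; apply: norm_cvg0.
  apply: (@squeeze_cvgr _ _ _ _ (cst 0) (fun n => (h ^+ 2)^-1 * n.+1%:R^-1 : R)).
  + near=> n; rewrite normr_ge0/=.
    have hn : n.+1%:R^-1 < h.
      by near: n; move/cvgr_lt : cve => /(_ _ h0).
    set A := `]-oo, _[%classic.
    have mA : measurable A by exact: measurable_itv.
    have -> : fine (normal_prob v (n.+1%:R^-1 ^+ 2) A) - 1 =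
        - fine (normal_prob v (n.+1%:R^-1 ^+ 2) (~` A)).
      have -> : fine (normal_prob v (n.+1%:R^-1 ^+ 2) (~` A)) =
          1 - fine (normal_prob v (n.+1%:R^-1 ^+ 2) A).
        have := congr1 fine (probability_setC (normal_prob v (n.+1%:R^-1 ^+ 2)) mA).
        by move=> ->; rewrite fineB//; apply: fin_num_measure; exact: mA.
      by rewrite opprB.
    rewrite normrN ger0_norm ?fine_ge0//.
    apply: (le_trans (@normal_tail _ v _ h _ (s0 n) h0 _ _)).
    * exact: measurableC.
    * move=> y; rewrite /A /= in_itv/= => /negP; rewrite -leNgt => cy.
      rewrite (le_trans _ (ler_norm _))//.
      have : c - v = h * 2 by rewrite /h divfK.
      move: hn cy; move: (n.+1%:R^-1) => e; lra.
    * rewrite mulrC ler_wpM2l// ?invr_ge0 ?sqr_ge0// -exprM.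
      have -> : (2 * 2 = 4)%N by [].
      rewrite exprS; apply: ler_piMr; first exact: ltW.
      by apply: exprn_ile1 => //; exact: ltW.
  + exact: cvg_cst.
  + by rewrite -[X in _ --> X](mulr0 (h ^+ 2)^-1); apply: cvgMr.
- rewrite indicE memNset/=; last by rewrite in_itv/= ltNge cv.
  apply: norm_cvg0.
  apply: (@squeeze_cvgr _ _ _ _ (cst 0) (fun n => n.+1%:R^-1 : R)) => //; last exact: cvg_cst.
  apply: nearW => n; rewrite normr_ge0/= ger0_norm ?fine_ge0//.
  apply: (le_trans (@normal_tail _ v _ _ _ (s0 n) (e0 n) _ _)).
  + exact: measurable_itv.
  + move=> y; rewrite /= in_itv/= => cy.
    rewrite distrC (le_trans _ (ler_norm _))//.
    move: cy cv; move: (n.+1%:R^-1) => e; lra.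
  + rewrite expr2 -mulrA divff ?mulr1 ?s0// expr2; apply: ler_piMr => //; exact: ltW.
Unshelve. all: by end_near. Qed.

(** * Signed weights with vanishing cosine integrals: one variable *)

Section FourierUniqueness.
Context {d : measure_display} {T : measurableType d} {R : realType}.
Variable P : probability T R.
Notation mu := (@lebesgue_measure R).
Variables (V G : T -> R).
Hypothesis mV : measurable_fun setT V.
Hypothesis bG : bounded_measurable G.
Hypothesis VG0 : forall t theta, \int[P]_x (G x * cos (t * V x + theta)) = 0.

(** Up to the constant [normal_peak s], the density of deviation s is the characteristic function of
    the centered normal law of deviation 1 / s, evaluated at V - a. Exchanging the integrals brings
    in the cosine integrals of G, which vanish. *)
Lemma fourier_gaussian_kernel (a s : R) : s != 0 ->
  \int[P]_x (G x * normal_pdf (V x) s a) = 0.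
Proof.
move=> s0; have s'0 : s^-1 != 0 by rewrite invr_eq0.
have K x : normal_pdf (V x) s a =
    normal_peak s * \int[normal_prob 0 s^-1]_y cos (y * (V x - a)).
  rewrite normal_pdfE// /normal_fun; congr (_ * _).
  under eq_Rintegral do rewrite mulrC -[X in cos X]addr0.
  rewrite normal_cos// mulr0 add0r cos0 mul1r; congr expR.
  by field.
have bc : bounded_measurable
    (fun z : T * R => normal_peak s * (G z.1 * cos (z.2 * (V z.1 - a)))).
  apply: bounded_measurableM; first exact: bounded_measurable_cst.
  apply: bounded_measurableM.
    by case: bG => mG [M hM]; split; [exact: measurableT_comp|exists M].
  apply: bounded_measurable_cos; apply: measurable_funM => //.
  by apply: measurable_funB => //; exact: measurableT_comp.
transitivity (\int[P]_x \int[normal_prob 0 s^-1]_(y in [set: R])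
    (normal_peak s * (G x * cos (y * (V x - a))))).
  have bcx x : bounded_measurable (fun y : R => cos (y * (V x - a))).
    by apply: bounded_measurable_cos; exact: measurable_funM.
  apply: eq_Rintegral => x _; rewrite K.
  under [RHS]eq_Rintegral do rewrite mulrA.
  rewrite RintegralZl//; first by rewrite mulrCA mulrA.
  by apply: bounded_measurable_integrable => //; exact: bcx.
have /= -> := bounded_measurable_Fubini P (normal_prob 0 s^-1) bc.
under eq_Rintegral => y _.
  rewrite RintegralZl//; last first.
    apply: bounded_measurable_integrable => //; apply: bounded_measurableM => //.
    by apply: bounded_measurable_cos; apply: measurable_funM => //; exact: measurable_funB.
  under eq_Rintegral do rewrite mulrBr -mulrN.
  rewrite VG0 mulr0; over.
by rewrite Rintegral_probability_cst.
Qed.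

(** Integrates [fourier_gaussian_kernel] in a over the ray. Fubini applies although Lebesgue measure
    is infinite, since the density has mass at most 1 on the ray and G is bounded. The measurability
    clause serves dominated convergence in [fourier_ray]. *)
Lemma fourier_gaussian_ray (c s : R) : s != 0 ->
  measurable_fun setT (fun x => (G x)%:E * normal_prob (V x) s `]-oo, c[%classic)%E /\
  (\int[P]_x ((G x)%:E * normal_prob (V x) s `]-oo, c[%classic) = 0)%E.
Proof.
move=> s0.
pose f (z : T * R) := G z.1 * (normal_pdf (V z.1) s z.2 * \1_(`]-oo, c[%classic) z.2).
have mf : measurable_fun setT f.
  apply: measurable_funM; first exact: (measurableT_comp bG.1).
  apply: measurable_funM; last first.
    have m1 : measurable_fun [set: R] (\1_(`]-oo, c[%classic : set R) : R -> R).
      exact: measurable_indic.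
    exact: (measurableT_comp m1 measurable_snd).
  have -> : (fun z : T * R => normal_pdf (V z.1) s z.2) =
    (fun z => normal_peak s * expR (- (z.2 - V z.1) ^+ 2 / (s ^+ 2 *+ 2))).
    by apply/funext => z; rewrite normal_pdfE.
  apply: measurable_funM => //; apply: measurableT_comp => //.
  apply: measurable_funM => //; apply: measurableT_comp => //.
  apply: measurable_funX; apply: measurable_funB; first exact: measurable_snd.
  exact: (measurableT_comp mV).
have [M hM] := bG.2.
have pdf_ge0 x a : 0 <= normal_pdf (V x) s a * \1_(`]-oo, c[%classic) a.
  by rewrite mulr_ge0// normal_pdf_ge0.
have pdfN x : (\int[mu]_a (normal_pdf (V x) s a * \1_(`]-oo, c[%classic) a)%:E =
    normal_prob (V x) s `]-oo, c[%classic)%E.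
  rewrite [RHS]integral_mkcond; apply: eq_integral => a _.
  by rewrite patchE indicE; case: ifPn => // _; rewrite ?mulr1 ?mulr0.
have mpdf x : measurable_fun [set: R]
    (fun a => (normal_pdf (V x) s a * \1_(`]-oo, c[%classic) a)%:E).
  apply/measurable_EFinP; apply: measurable_funM; first exact: measurable_normal_pdf.
  exact: measurable_indic.
have intf : (P \x mu)%E.-integrable setT (EFin \o f).
  apply/integrable12ltyP; first exact/measurable_EFinP.
  apply: (@le_lt_trans _ _ (\int[P]_x M%:E)%E); last first.
    rewrite integral_cst//= lte_mul_pinfty//.
    - by rewrite lee_fin (le_trans _ (hM point)).
    - by rewrite (le_lt_trans (probability_le1 P measurableT))// ltry.
  apply: ge0_le_integral => //.
  - by move=> x _; exact: integral_ge0.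
  - apply: (@measurable_fun_fubini_tonelli_F _ _ _ _ _ mu (abse \o (EFin \o f))).
      by apply: measurableT_comp => //; exact/measurable_EFinP.
    by move=> x /=.
  - move=> x _ /=.
    rewrite (_ : (fun y => _) = (fun y => (`|G x|)%:E *
        (normal_pdf (V x) s y * \1_(`]-oo, c[%classic) y)%:E)%E); last first.
      by apply/funext => y; rewrite -EFinM /f /= normrM (ger0_norm (pdf_ge0 _ _)).
    rewrite ge0_integralZl//; last 2 first.
      exact: mpdf.
      by move=> y _; rewrite lee_fin.
    rewrite pdfN (@le_trans _ _ (`|G x|%:E * 1)%E)//.
      by rewrite lee_wpmul2l// probability_le1.
    by rewrite mule1 lee_fin.
have inner x : (\int[mu]_a (f (x, a))%:E =
    (G x)%:E * normal_prob (V x) s `]-oo, c[%classic)%E.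
  rewrite -pdfN -integralZl//.
  apply/integrableP; split; first exact: mpdf.
  under eq_integral do rewrite /= ger0_norm//.
  by rewrite pdfN (le_lt_trans (probability_le1 _ _))// ltry.
split.
  rewrite (_ : (fun x => _) = fubini_F mu (EFin \o f)).
    exact: measurable_fubini_F intf.
  by apply/funext => x; rewrite -inner.
transitivity (\int[P]_x \int[mu]_a (f (x, a))%:E)%E.
  by apply: eq_integral => x _; rewrite inner.
rewrite (Fubini intf) integral0_eq// => a _ /=.
have b1 : bounded_measurable (fun x => G x * normal_pdf (V x) s a).
  apply: bounded_measurableM => //; split.
    have -> : (fun x => normal_pdf (V x) s a) =
      (fun x => normal_peak s * expR (- (a - V x) ^+ 2 / (s ^+ 2 *+ 2))).
      by apply/funext => z; rewrite normal_pdfE.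
    apply: measurable_funM => //; apply: measurableT_comp => //.
    apply: measurable_funM => //; apply: measurableT_comp => //.
    by apply: measurable_funX; exact: measurable_funB.
  exists (normal_peak s) => x; rewrite ger0_norm ?normal_pdf_ge0//.
  exact: normal_pdf_ub.
transitivity ((\int[P]_x (\1_(`]-oo, c[%classic) a * (G x * normal_pdf (V x) s a)))%:E).
  rewrite /Rintegral fineK.
    by apply: eq_integral => x _; rewrite /f /=; congr EFin; ring.
  apply: integrable_fin_num => //; apply: bounded_measurable_integrable => //.
  by apply: bounded_measurableM => //; exact: bounded_measurable_cst.
rewrite RintegralZl//; first by rewrite fourier_gaussian_kernel// mulr0.
exact: bounded_measurable_integrable.
Qed.

(** Lets the smoothing scale tend to 0 along the deviations and endpoints of
    [normal_prob_concentrates]; the bound of G dominates. *)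
Lemma fourier_ray (c : R) :
  (\int[P]_(x in V @^-1` `]-oo, c[%classic) (G x)%:E = 0)%E.
Proof.
have s0 n : n.+1%:R^-1 ^+ 2 != 0 :> R by rewrite expf_neq0// invr_eq0.
have mS : measurable (V @^-1` `]-oo, c[%classic).
  by rewrite -[_ @^-1` _]setTI; apply: mV => //; exact: measurable_itv.
have [M hM] := bG.2.
pose f n x := ((G x)%:E * normal_prob (V x) ((n.+1%:R^-1 ^+ 2)%R)
  `]-oo, (c - n.+1%:R^-1)%R[%classic)%E.
have hf n := fourier_gaussian_ray (c - n.+1%:R^-1) (s0 n).
have := @dominated_convergence _ _ _ P setT measurableT f
  (fun x => (G x * \1_(V @^-1` `]-oo, c[%classic) x)%:E) (fun=> M%:E).
case.
- by move=> n; exact: (hf n).1.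
- apply/measurable_EFinP; apply: measurable_funM; first exact: bG.1.
  exact: measurable_indic.
- apply: aeW => x _; rewrite EFinM; apply: cvgeM; first by [].
  + exact: cvg_cst.
  + have := @normal_prob_concentrates R (V x) c.
    rewrite (_ : \1_(V @^-1` _) x = \1_(`]-oo, c[%classic : set R) (V x))//.
    move=> h; apply/fine_cvgP; split; last exact: h.
    by apply: nearW => n; apply: fin_num_measure; exact: measurable_itv.
- by apply: bounded_measurable_integrable => //; exact: bounded_measurable_cst.
- apply: aeW => x n _; rewrite /f abseM -[leRHS]mule1.
  apply: lee_pmul => //; first by rewrite /= lee_fin.
  by rewrite gee0_abs// probability_le1//; exact: measurable_itv.
move=> _ _; rewrite (_ : [sequence _]_n = cst 0%E); last first.
  by apply/funext => n /=; exact: (hf n).2.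
move=> /(cvg_unique (@ereal_hausdorff R) (cvg_cst _)) h.
rewrite integral_mkcond [RHS]h; apply: eq_integral => x _.
by rewrite patchE indicE; case: ifPn => // _; rewrite ?mulr1 ?mulr0.
Qed.

Lemma fourier_uniqueness (D : set R) : measurable D ->
  (\int[P]_(x in V @^-1` D) (G x)%:E = 0)%E.
Proof.
move=> mD.
pose C := preimage_set_system setT V (@RGenInftyO.G R).
apply: (@zero_integral_g_sigma _ _ _ P G C).
- exact: bG.
- move=> _ _ [_ [a ->] <-] [_ [b ->] <-].
  exists (`]-oo, Num.min a b[%classic); first by exists (Num.min a b).
  rewrite !setTI -preimage_setI; congr (_ @^-1` _).
  by apply/seteqP; split=> x /=; rewrite !in_itv/= lt_min => /andP.
- move=> _ [_ [a ->] <-]; apply: mV => //; exact: measurable_itv.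
(* At t = theta = 0 the hypothesis is that G itself integrates to zero. *)
- have := VG0 0 0; under eq_Rintegral do rewrite mul0r addr0 cos0 mulr1.
  by [].
- by move=> _ [_ [a ->] <-]; rewrite setTI; exact: fourier_ray.
- rewrite g_sigma_preimageE; exists D; last by rewrite setTI.
  by have /seteqP[+ _] := RGenInftyO.measurableE R; apply.
Qed.

End FourierUniqueness.

Lemma cosM {R : realType} (a b : R) :
  cos a * cos b = 2^-1 * (cos (a + b) + cos (a - b)).
Proof. by rewrite cosB cosD; field. Qed.

(** * Signed weights with vanishing cosine integrals: several variables *)

Section MultivariateFourier.
Context {d : measure_display} {T : measurableType d} {R : realType}.
Variable P : probability T R.

Lemma bounded_measurable_prod_indic (I : eqType) (V : I -> T -> R)
    (D : I -> set R) (l : seq I) :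
  (forall i, measurable_fun setT (V i)) -> (forall i, measurable (D i)) ->
  bounded_measurable (fun x => \prod_(i <- l) (\1_(D i) (V i x) : R)).
Proof.
move=> mV mD; elim: l => [|i l IH].
  have -> : (fun x => \prod_(i <- [::]) (\1_(D i) (V i x) : R)) = cst 1.
    by apply/funext => x; rewrite big_nil.
  exact: bounded_measurable_cst.
have -> : (fun x => \prod_(j <- i :: l) (\1_(D j) (V j x) : R)) =
    (fun x => \1_(V i @^-1` D i) x * \prod_(j <- l) \1_(D j) (V j x)).
  by apply/funext => x; rewrite big_cons.
apply: bounded_measurableM => //; apply: bounded_measurable_indic.
by rewrite -[_ @^-1` _]setTI; exact: mV.
Qed.

(** Induction on the coordinates, with G arbitrary. The head coordinate is treated by the
    one-variable result for the weight G times the remaining indicators. Its cosine integrals vanish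
    by the induction hypothesis for the weight G cos (t V_i + eta), because [cosM] reduces the
    cosine integrals of the latter to those of G over the longer list. *)
Lemma fourier_rectangle (I : eqType) (V : I -> T -> R) (D : I -> set R)
    (l : seq I) (G : T -> R) :
  (forall i, measurable_fun setT (V i)) -> (forall i, measurable (D i)) ->
  uniq l -> bounded_measurable G ->
  (forall (s : I -> R) (theta : R),
    \int[P]_x (G x * cos (\sum_(i <- l) s i * V i x + theta)) = 0) ->
  \int[P]_x (G x * \prod_(i <- l) \1_(D i) (V i x)) = 0.
Proof.
move=> mV mD; elim: l G => [|i l IH] G /=.
  move=> _ bG /(_ (fun=> 0) 0).
  under eq_Rintegral do rewrite big_nil addr0 cos0.
  by under [in X in _ -> X]eq_Rintegral do rewrite big_nil.
move=> /andP[il ul] bG G0.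
have mlin (l' : seq I) (s : I -> R) : measurable_fun setT (fun x => \sum_(j <- l') s j * V j x).
  by apply: measurable_sum => j; exact: measurable_funM.
pose Q x := \prod_(j <- l) (\1_(D j) (V j x) : R).
have bQ : bounded_measurable Q by exact: bounded_measurable_prod_indic.
have Gi t eta : \int[P]_x (G x * Q x * cos (t * V i x + eta)) = 0.
  under eq_Rintegral do rewrite mulrAC.
  have mi : measurable_fun setT (fun x => t * V i x + eta).
    by apply: measurable_funD => //; exact: measurable_funM.
  apply: IH => //.
    by apply: bounded_measurableM => //; exact: bounded_measurable_cos.
  move=> s theta.
  (* The values e = 1 and e = -1 give the sum and the difference of the two arguments in [cosM]. *)
  pose s1 e j := if j == i then t else e * s j.
  have sum1 e x : \sum_(j <- i :: l) s1 e j * V j x =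
      t * V i x + e * \sum_(j <- l) s j * V j x.
    rewrite big_cons /s1 eqxx mulr_sumr; congr (_ + _).
    apply: eq_big_seq => j jl; rewrite ifN ?mulrA//.
    by apply: contraNneq il => <-.
  have h e th : \int[P]_x (G x * cos (\sum_(j <- i :: l) s1 e j * V j x + th)) = 0.
    exact: G0.
  have ih e th : P.-integrable setT (EFin \o (fun x =>
      G x * cos (\sum_(j <- i :: l) s1 e j * V j x + th))).
    apply: bounded_measurable_integrable => //; apply: bounded_measurableM => //.
    by apply: bounded_measurable_cos; apply: measurable_funD.
  transitivity (2^-1 * (\int[P]_x (
      G x * cos (\sum_(j <- i :: l) s1 1 j * V j x + (eta + theta)) +
      G x * cos (\sum_(j <- i :: l) s1 (-1) j * V j x + (eta - theta))))).
    rewrite -RintegralZl//.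
      apply: eq_Rintegral => x _; rewrite -mulrA cosM !sum1.
      rewrite -mulrDr mulrCA; congr (_ * (_ * (cos _ + cos _))); ring.
    apply: bounded_measurable_integrable => //; apply: bounded_measurableD;
      apply: bounded_measurableM => //;
      by apply: bounded_measurable_cos; apply: measurable_funD.
  by rewrite RintegralD// !h addr0 mulr0.
have mA : measurable (V i @^-1` D i) by rewrite -[_ @^-1` _]setTI; exact: mV.
have h : \int[P]_(x in V i @^-1` D i) (G x * Q x) = 0.
  rewrite /Rintegral (@fourier_uniqueness _ _ _ P (V i) (fun x => G x * Q x))//.
  exact: bounded_measurableM.
rewrite -[RHS]h -[RHS]Rintegral_indicM//.
by apply: eq_Rintegral => x _; rewrite big_cons -mulrA [X in _ = _ * X]mulrC.
Qed.

(** The preimages under single coordinates that generate [g_sigma_preimage] are not closed under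
    intersection; rectangles are, and they contain these preimages. *)
Lemma fourier_g_sigma_preimage (n : nat) (V : 'I_n -> T -> R) (G : T -> R) :
  (forall i, measurable_fun setT (V i)) -> bounded_measurable G ->
  (forall (s : 'I_n -> R) (theta : R),
    \int[P]_x (G x * cos (\sum_(i < n) s i * V i x + theta)) = 0) ->
  forall A, g_sigma_preimage V A -> (\int[P]_(x in A) (G x)%:E = 0)%E.
Proof.
move=> mV bG G0 A sA.
pose C := [set A : set T | exists D : 'I_n -> set R, (forall i, measurable (D i)) /\
  A = [set x | forall i, D i (V i x)]].
have CE (D : 'I_n -> set R) : [set x | forall i, D i (V i x)] =
    \bigcap_(i in [set: 'I_n]) (V i @^-1` D i).
  by apply/seteqP; split => x /= h i; [move=> _|]; exact: h.
have Cm : C `<=` measurable.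
  move=> _ [D [mD ->]]; rewrite CE; apply: fin_bigcap_measurable => // i _.
  by rewrite -[_ @^-1` _]setTI; exact: mV.
apply: (@zero_integral_g_sigma _ _ _ P G C) => //.
- move=> _ _ [D1 [m1 ->]] [D2 [m2 ->]]; exists (fun i => D1 i `&` D2 i); split.
    by move=> i; exact: measurableI.
  by apply/seteqP; split => x /= => [[h1 h2] i|h]; [split|split => i; case: (h i)].
- have := G0 (fun=> 0) 0; rewrite (_ : (fun x => G x * _) = G)//.
  apply/funext => x; rewrite big1 ?addr0 ?cos0 ?mulr1// => i _.
  by rewrite mul0r.
- move=> B CB; have mB := Cm _ CB; case: CB mB => D [mD ->] mB.
  have := @fourier_rectangle _ V D (index_enum 'I_n) G mV mD (index_enum_uniq _) bG G0.
  rewrite (_ : (fun x => G x * _) =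
      (fun x => G x * \1_[set x | forall i, D i (V i x)] x)); last first.
    apply/funext => x; congr (_ * _); rewrite indicE.
    have [/set_mem /= h|/negP h] := boolP (x \in _).
      by rewrite big1// => i _; rewrite indicE mem_set//.
    have [i hi] : exists i, ~ D i (V i x).
      by apply/existsNP => h'; apply: h; exact/mem_set.
    by rewrite (bigD1 i)//= indicE memNset// mul0r.
  rewrite Rintegral_indicM// => h.
  rewrite -(fineK (integrable_fin_num mB (bounded_measurable_integrable P mB bG))).
  by move: h; rewrite /Rintegral => ->.
- apply: smallest_sub sA; first exact: smallest_sigma_algebra.
  apply: (@big_ind _ (fun S : set (set T) => S `<=` <<s C >>)) => //.
    by move=> S1 S2 h1 h2 x [/h1|/h2].
  move=> i _ _ [D mD <-]; apply: sub_sigma_algebra.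
  exists (fun j => if j == i then D else setT); split.
    by move=> j; case: ifP.
  rewrite setTI; apply/seteqP; split => x /= => [h j|/(_ i)]; last by rewrite eqxx.
  by case: eqP => // ->.
Qed.

End MultivariateFourier.

(** * The Gaussian space spanned by the information process *)

Section RealIntegrable.
Context {d : measure_display} {T : measurableType d} {R : realType}.
Variable mu : {measure set T -> \bar R}.

Lemma integrableRD (f g : T -> R) : mu.-integrable setT (EFin \o f) ->
  mu.-integrable setT (EFin \o g) ->
  mu.-integrable setT (EFin \o (fun x => f x + g x)).
Proof.
by move=> hf hg; have := integrableD measurableT hf hg; apply: eq_integrable.
Qed.

Lemma integrableRZ (f : T -> R) (k : R) : mu.-integrable setT (EFin \o f) ->
  mu.-integrable setT (EFin \o (fun x => k * f x)).
Proof.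
by move=> hf; have := integrableZl measurableT k hf; apply: eq_integrable.
Qed.
End RealIntegrable.

Section ImageIntegral.
Context {d1 d2 : measure_display} {X : measurableType d1} {Y : measurableType d2}
  {R : realType}.
Variables (phi : X -> Y) (mphi : measurable_fun setT phi).
Variables (mu : {measure set X -> \bar R}) (nu : {measure set Y -> \bar R}).
Hypothesis image : forall A, measurable A -> mu (phi @^-1` A) = nu A.
Let mphi_mixin := isMeasurableFun.Build _ _ _ _ _ mphi.
Let mphi_pack : {mfun X >-> Y} := HB.pack phi mphi_mixin.

Lemma ge0_integral_image (f : Y -> \bar R) : measurable_fun setT f ->
  (forall y, 0 <= f y)%E -> (\int[nu]_y f y = \int[mu]_x f (phi x))%E.
Proof.
move=> mf f0.
rewrite -(@eq_measure_integral _ _ _ _ nu (pushforward mu mphi_pack)).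
  by rewrite ge0_integral_pushforward.
by move=> A mA _; rewrite -image.
Qed.

Lemma integrable_image (f : Y -> R) : measurable_fun setT f ->
  nu.-integrable setT (EFin \o f) -> mu.-integrable setT (EFin \o (f \o phi)).
Proof.
move=> mf /integrableP[_ h]; apply/integrableP; split.
  by apply/measurable_EFinP; exact: measurableT_comp.
rewrite -(@ge0_integral_image (abse \o (EFin \o f)))//; last by move=> y /=.
by apply: measurableT_comp => //; exact/measurable_EFinP.
Qed.

Lemma Rintegral_image (f : Y -> R) : measurable_fun setT f ->
  \int[nu]_y f y = \int[mu]_x f (phi x).
Proof.
move=> mf; rewrite /Rintegral; congr fine.
rewrite [LHS]integralE [RHS]integralE.
have mp : measurable_fun setT ((EFin \o f)^\+)%E.
  by apply: measurable_funepos; exact/measurable_EFinP.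
have mn : measurable_fun setT ((EFin \o f)^\-)%E.
  by apply: measurable_funeneg; exact/measurable_EFinP.
have := ge0_integral_image mp => -> //.
have := ge0_integral_image mn => -> //.
by congr (_ - _)%E; apply: eq_integral => x _; rewrite ?funeposE ?funenegE.
Qed.
End ImageIntegral.

Section GaussianLaw.
Context {d : measure_display} {T : measurableType d} {R : realType}.
Variable P : probability T R.

Lemma normal_moments (m s : R) : s != 0 ->
  [/\ (normal_prob m s).-integrable setT (EFin \o (@id R)),
      (normal_prob m s).-integrable setT (EFin \o (fun x : R => x ^+ 2)),
      \int[normal_prob m s]_x x = m,
      \int[normal_prob m s]_x (x ^+ 2) = m ^+ 2 + s ^+ 2
    & forall theta, \int[normal_prob m s]_x cos (x + theta) =
        cos (m + theta) * expR (- s ^+ 2 / 2)].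
Proof.
move=> s0.
have msub : measurable_fun [set: R] (fun x : R => x - m) by exact: measurable_funB.
have i1 : (normal_prob m s).-integrable setT (EFin \o (fun x : R => x - m)).
  apply: (@normal_integrable _ m s s0 _ 1) => // x.
  by rewrite mul1r ler_norm_1Dsqr.
have i2 : (normal_prob m s).-integrable setT (EFin \o (fun x : R => (x - m) ^+ 2)).
  apply: (@normal_integrable _ m s s0 _ 1) => //; first exact: measurable_funX.
  by move=> x; rewrite mul1r ger0_norm ?sqr_ge0// lerDr.
have ic (c : R) : (normal_prob m s).-integrable setT (EFin \o cst c).
  by apply: bounded_measurable_integrable => //; exact: bounded_measurable_cst.
have iid : (normal_prob m s).-integrable setT (EFin \o (@id R)).
  have -> : @id R = (fun x => (x - m) + m) by apply/funext => x; rewrite subrK.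
  exact: (integrableRD i1 (ic m)).
have ilin : (normal_prob m s).-integrable setT (EFin \o (fun x : R => 2 * m * (x - m))).
  exact: (integrableRZ (2 * m) i1).
have ilin2 : (normal_prob m s).-integrable setT
    (EFin \o (fun x : R => (x - m) ^+ 2 + 2 * m * (x - m))).
  exact: (integrableRD i2 ilin).
have E2 : (fun x : R => x ^+ 2) = (fun x => ((x - m) ^+ 2 + 2 * m * (x - m)) + m ^+ 2).
  by apply/funext => x; ring.
split.
- exact: iid.
- by rewrite E2; exact: (integrableRD ilin2 (ic (m ^+ 2))).
- transitivity (\int[normal_prob m s]_x ((x - m) + m)).
    by apply: eq_Rintegral => x _; rewrite subrK.
  rewrite RintegralD//; last exact: (ic m).
  by rewrite normal_centered// add0r Rintegral_probability_cst.
- rewrite E2 RintegralD//; last exact: (ic (m ^+ 2)).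
  rewrite RintegralD// RintegralZl// normal_centered// normal_second_moment//.
  by rewrite Rintegral_probability_cst mulr0 addr0 addrC.
- move=> theta; have := normal_cos m s0 1 theta; rewrite !mul1r => <-.
  by apply: eq_Rintegral => x _; rewrite mul1r.
Qed.

(** The formulas are uniform in s: at s = 0 they are those of the Dirac mass, so degenerate Gaussian
    variables need no separate treatment later. *)
Lemma gaussian_law_moments (U : T -> R) : measurable_fun setT U ->
  gaussian_law P U -> exists m s : R,
  [/\ P.-integrable setT (EFin \o U),
      P.-integrable setT (EFin \o (fun w => U w ^+ 2)),
      \int[P]_w U w = m,
      \int[P]_w (U w ^+ 2) = m ^+ 2 + s ^+ 2
    & forall theta, \int[P]_w cos (U w + theta) =
        cos (m + theta) * expR (- s ^+ 2 / 2)] /\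
  (s != 0 -> forall A : set R, measurable A -> P (U @^-1` A) = normal_prob m s A).
Proof.
move=> mU [m [s lawU]]; exists m, s; split; last first.
  by move=> s0 A mA; have := lawU A mA; rewrite (negbTE s0).
have mU' : @measurable_fun _ _ T (measurableTypeR R) setT U := mU.
have mid : measurable_fun [set: R] (@id R) by [].
have msq : measurable_fun [set: R] (fun x : R => x ^+ 2) by exact: measurable_funX.
have mcos theta : measurable_fun [set: R] (fun x : R => cos (x + theta)).
  by have [] := bounded_measurable_cos (measurable_funD mid (@measurable_cst _ _ _ _ setT theta)).
suff [nu [lawnu [h1 h2 h3 h4 h5]]] : exists nu : probability (measurableTypeR R) R,
    (forall A : set (measurableTypeR R), measurable A -> P (U @^-1` A) = nu A) /\
    [/\ nu.-integrable setT (EFin \o (@id R)),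
      nu.-integrable setT (EFin \o (fun x : R => x ^+ 2)),
      \int[nu]_x x = m,
      \int[nu]_x (x ^+ 2) = m ^+ 2 + s ^+ 2
    & forall theta, \int[nu]_x cos (x + theta) =
        cos (m + theta) * expR (- s ^+ 2 / 2)].
  split.
  - by have := @integrable_image _ _ _ (measurableTypeR R) R _ mU' P nu lawnu _ mid h1; apply: eq_integrable.
  - by have := @integrable_image _ _ _ (measurableTypeR R) R _ mU' P nu lawnu _ msq h2; apply: eq_integrable.
  - by rewrite -h3 (@Rintegral_image _ _ _ (measurableTypeR R) R _ mU' P nu lawnu _ mid).
  - by rewrite -h4 (@Rintegral_image _ _ _ (measurableTypeR R) R _ mU' P nu lawnu _ msq).
  - by move=> theta; rewrite -h5 (@Rintegral_image _ _ _ (measurableTypeR R) R _ mU' P nu lawnu _ (mcos theta)).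
have [s0|s0] := eqVneq s 0; last first.
  exists (normal_prob m s); split; last exact: normal_moments.
  by move=> A mA; have := lawU A mA; rewrite (negbTE s0).
pose dm : probability (measurableTypeR R) R := @dirac _ (measurableTypeR R) m R.
exists dm; split.
  by move=> A mA; have := lawU A mA; rewrite s0 eqxx.
have id (f : R -> R) : measurable_fun [set: R] f -> \int[dm]_x f x = f m.
  move=> mf; rewrite /Rintegral /dm integral_dirac//; last exact/measurable_EFinP.
  by rewrite diracT mul1e.
have ii (f : R -> R) : measurable_fun [set: R] f ->
    dm.-integrable setT (EFin \o f).
  move=> mf; apply/integrableP; split; first exact/measurable_EFinP.
  rewrite /dm integral_dirac//; last first.
    by apply: measurableT_comp => //; exact/measurable_EFinP.
  by rewrite diracT mul1e ltry.
split; [exact: ii|exact: ii|exact: id| |].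
- by rewrite id// s0 expr0n/= addr0.
- by move=> theta; rewrite id// s0 expr0n/= oppr0 mul0r expR0 mulr1.
Qed.

(** The substitution x -> - x / s carries the ray above - z to the ray below z / s, and the density
    is even. This turns the event 0 < z + W into a value of [Phi]. *)
Lemma normal_prob_upper_ray (s z : R) : 0 < s ->
  normal_prob 0 s [set x | 0 < z + x] = normal_prob 0 1 `]-oo, z / s]%classic.
Proof.
move=> s0; have sn0 : s != 0 by rewrite gt_eqF.
have -> : [set x | 0 < z + x] = `]- z, +oo[%classic :> set R.
  by apply/seteqP; split => x /=; rewrite in_itv/= andbT -ltrBlDl sub0r.
pose F : R -> R := (fun x => - s^-1 * x).
have dF (x : R) : is_derive x (1 : R) F (- s^-1).
  have -> : F = cst (- s^-1) * id by [].
  by apply: is_derive_eq; rewrite /GRing.scale /= mulr1 mulr0 addr0.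
have F' : F^`()%classic = cst (- s^-1).
  by apply/funext => x; rewrite derive1E; have [_ ->] := dF x.
have cF : continuous F.
  by move=> x; apply/differentiable_continuous/derivable1_diffP; have [] := dF x.
rewrite /normal_prob integral_itv_obnd_cbnd; last first.
  by apply/measurable_EFinP/measurable_funTS; exact: measurable_normal_pdf.
have -> : z / s = F (- z) by rewrite /F mulrNN mulrC.
rewrite (@decreasing_ge0_integration_by_substitutiony _ F (normal_pdf 0 1) (- z)).
- apply: eq_integral => x _; congr EFin; rewrite F' !fctE /= opprK.
  rewrite !normal_pdfE// /normal_fun !subr0 /F [RHS]mulrAC; congr (_ * expR _).
    rewrite /normal_peak expr1n mul1r -mulrnAr sqrtrM ?sqr_ge0//.
    by rewrite sqrtr_sqr gtr0_norm// invfM mulrC.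
  by field.
- move=> x y _ _ xy; rewrite /F !mulNr ltrN2 ltr_pM2l// invr_gt0//.
- by move=> x _; rewrite F'; exact: cst_continuous.
- by rewrite F'; exact: is_cvg_cst.
- by rewrite F'; exact: is_cvg_cst.
- by split; [move=> x _; have [] := dF x|exact/cvg_at_right_filter/cF].
- rewrite (_ : F = (fun x => - (s^-1 * x))); last by apply/funext => x; rewrite /F mulNr.
  apply/cvgNrNy; apply: gt0_cvgMry; last exact: cvg_id.
  by rewrite invr_gt0.
- by apply: continuous_subspaceT; exact: continuous_normal_pdf.
- by move=> x _; exact: normal_pdf_ge0.
Qed.

End GaussianLaw.

Section GaussianSpace.
Context {d : measure_display} {T : measurableType d} {R : realType}.
Variable P : probability T R.
Variable X : set (measurableTypeR R) -> {RV P >-> R}.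
Hypothesis hX : gaussian_information_model X.

(** The linear span of the X_B. With lists, sums become concatenations and [gim_gaussian] applies
    with n the size of the list. *)
Definition gaussian_space (f : T -> R) : Prop :=
  exists2 l : seq (R * set (measurableTypeR R)),
    (forall k, (k < size l)%N -> borel_subset_S (nth (0, set0) l k).2) &
    f = fun w => \sum_(c <- l) c.1 * X c.2 w.

Lemma gaussian_space_X B : borel_subset_S B -> gaussian_space (X B).
Proof.
move=> mB; exists [:: (1, B)]; first by case.
by apply/funext => w; rewrite big_seq1 mul1r.
Qed.

Lemma gaussian_space0 : gaussian_space (fun=> 0).
Proof. by exists [::] => //; apply/funext => w; rewrite big_nil. Qed.

Lemma gaussian_spaceD f g : gaussian_space f -> gaussian_space g ->
  gaussian_space (fun w => f w + g w).
Proof.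
move=> [l hl ->] [k hk ->]; exists (l ++ k).
  move=> i; rewrite size_cat nth_cat => ilk.
  by case: ltnP => il; [exact: hl|apply: hk; rewrite ltn_subLR].
by apply/funext => w; rewrite big_cat.
Qed.

Lemma gaussian_spaceZ c f : gaussian_space f -> gaussian_space (fun w => c * f w).
Proof.
move=> [l hl ->]; exists [seq (c * e.1, e.2) | e <- l].
  by move=> i; rewrite size_map => il; rewrite (nth_map (0, set0))//; exact: hl.
by apply/funext => w; rewrite big_map mulr_sumr; apply: eq_bigr => e _; rewrite mulrA.
Qed.

Lemma gaussian_space_sum (I : Type) (r : seq I) (c : I -> R) (F : I -> T -> R) :
  (forall i, gaussian_space (F i)) ->
  gaussian_space (fun w => \sum_(i <- r) c i * F i w).
Proof.
move=> hF; elim: r => [|i r IH].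
  by under eq_fun do rewrite big_nil; exact: gaussian_space0.
under eq_fun do rewrite big_cons.
by apply: gaussian_spaceD => //; exact: gaussian_spaceZ.
Qed.

Lemma gaussian_space_measurable f : gaussian_space f -> measurable_fun setT f.
Proof.
move=> [l _ ->]; apply: measurable_sum => e.
by apply: measurable_funM => //; exact: measurable_funP.
Qed.

Lemma gaussian_space_law f : gaussian_space f -> gaussian_law P f.
Proof.
move=> [l hl ->].
have := @gim_gaussian _ _ _ _ _ hX (size l) (fun k => (nth (0, set0) l k).2)
  (fun k => (nth (0, set0) l k).1) (fun k => hl _ (ltn_ord k)).
rewrite (_ : (fun w => _) = (fun w => \sum_(c <- l) c.1 * X c.2 w))//.
apply/funext => w; rewrite [RHS](big_nth (0, set0)) big_mkord.
by [].
Qed.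

Lemma gaussian_space_integrable f : gaussian_space f ->
  P.-integrable setT (EFin \o f).
Proof.
move=> hf; have [m [s [[]]]] := gaussian_law_moments (gaussian_space_measurable hf)
  (gaussian_space_law hf).
by [].
Qed.

Lemma gaussian_space_sqr_integrable f : gaussian_space f ->
  P.-integrable setT (EFin \o (fun w => f w ^+ 2)).
Proof.
move=> hf; have [m [s [[]]]] := gaussian_law_moments (gaussian_space_measurable hf)
  (gaussian_space_law hf).
by [].
Qed.

(** Polarization: 4 f g = (f + g)^2 - (f - g)^2. *)
Lemma gaussian_space_mul_integrable f g : gaussian_space f -> gaussian_space g ->
  P.-integrable setT (EFin \o (fun w => f w * g w)).
Proof.
move=> hf hg.
have := integrableRD (integrableRZ 4^-1 (gaussian_space_sqr_integrable (gaussian_spaceD hf hg)))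
  (integrableRZ (- 4^-1) (gaussian_space_sqr_integrable
    (gaussian_spaceD hf (gaussian_spaceZ (-1) hg)))).
apply: eq_integrable => // w _ /=; congr EFin; by field.
Qed.

Lemma gaussian_space_centered f : gaussian_space f -> \int[P]_w f w = 0.
Proof.
move=> [l hl ->].
elim: l hl => [|e l IH] hl.
  under eq_Rintegral do rewrite big_nil.
  by rewrite Rintegral_probability_cst.
have hl' k : (k < size l)%N -> borel_subset_S (nth (0, set0) l k).2.
  by move=> kl; exact: (hl k.+1).
have he : borel_subset_S e.2 by exact: (hl 0%N).
have iX := gaussian_space_integrable (gaussian_space_X he).
under eq_Rintegral do rewrite big_cons.
rewrite RintegralD//; last 2 first.
- exact: (integrableRZ e.1 iX).
- by apply: gaussian_space_integrable; exists l.
rewrite IH// addr0 RintegralZl//.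
have := gim_centered hX he; rewrite unlock => h.
by rewrite /Rintegral h mulr0.
Qed.

(** On [gaussian_space] this is the covariance, the elements being centered. *)
Definition inner f g := \int[P]_w (f w * g w).

Lemma innerC f g : inner f g = inner g f.
Proof. by apply: eq_Rintegral => w _; rewrite mulrC. Qed.

Lemma innerDr f g h : gaussian_space f -> gaussian_space g -> gaussian_space h ->
  inner f (fun w => g w + h w) = inner f g + inner f h.
Proof.
move=> hf hg hh; rewrite /inner; under eq_Rintegral do rewrite mulrDr.
by rewrite RintegralD//; exact: gaussian_space_mul_integrable.
Qed.

Lemma innerZr c f g : gaussian_space f -> gaussian_space g ->
  inner f (fun w => c * g w) = c * inner f g.
Proof.
move=> hf hg; rewrite /inner; under eq_Rintegral do rewrite mulrCA.
by rewrite RintegralZl//; exact: gaussian_space_mul_integrable.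
Qed.

Lemma inner_sumr (I : Type) (r : seq I) (c : I -> R) (F : I -> T -> R) f :
  gaussian_space f -> (forall i, gaussian_space (F i)) ->
  inner f (fun w => \sum_(i <- r) c i * F i w) = \sum_(i <- r) c i * inner f (F i).
Proof.
move=> hf hF; elim: r => [|i r IH].
  rewrite big_nil /inner; under eq_Rintegral do rewrite big_nil mulr0.
  by rewrite Rintegral_probability_cst.
rewrite big_cons -IH -innerZr// -innerDr//.
- by congr inner; apply/funext => w; rewrite big_cons.
- exact: gaussian_spaceZ.
- exact: gaussian_space_sum.
Qed.

Lemma inner_X A B : borel_subset_S A -> borel_subset_S B ->
  (inner (X A) (X B))%:E = lebesgue_measure (A `&` B).
Proof.
move=> hA hB; rewrite -(gim_covariance hX hA hB) unlock.
rewrite !(gim_centered hX)// unlock /inner /Rintegral fineK.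
  by apply: eq_integral => w _ /=; rewrite ?fctE /= ?subr0.
by apply: integrable_fin_num => //; apply: gaussian_space_mul_integrable;
  exact: gaussian_space_X.
Qed.

Lemma gaussian_space_cos f theta : gaussian_space f ->
  \int[P]_w cos (f w + theta) = cos theta * expR (- inner f f / 2).
Proof.
move=> hf; have [m [s [[_ _ h1 h2 h3] _]]] :=
  gaussian_law_moments (gaussian_space_measurable hf) (gaussian_space_law hf).
have m0 : m = 0 by rewrite -h1 gaussian_space_centered.
have -> : inner f f = s ^+ 2.
  rewrite [RHS](_ : _ = m ^+ 2 + s ^+ 2); last by rewrite m0 expr0n add0r.
  by rewrite -h2; apply: eq_Rintegral => w _; rewrite expr2.
by rewrite h3 m0 add0r.
Qed.

Lemma gaussian_space_normal f (s : R) : gaussian_space f ->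
  inner f f = s ^+ 2 -> 0 < s ->
  forall A : set R, measurable A -> P (f @^-1` A) = normal_prob 0 s A.
Proof.
move=> hf fs s0; have [m [s' [[_ _ h1 h2 h3] law]]] :=
  gaussian_law_moments (gaussian_space_measurable hf) (gaussian_space_law hf).
have m0 : m = 0 by rewrite -h1 gaussian_space_centered.
have E : s ^+ 2 = s' ^+ 2.
  rewrite -fs [RHS](_ : _ = m ^+ 2 + s' ^+ 2); last by rewrite m0 expr0n add0r.
  by rewrite -h2; apply: eq_Rintegral => w _; rewrite expr2.
have sn0 : s != 0 by rewrite gt_eqF.
have s'0 : s' != 0 by rewrite -sqrf_eq0 -E sqrf_eq0.
(* The deviation s' is determined only up to sign, but the density depends on its square alone. *)
move=> A mA; rewrite (law s'0 A mA) m0 /normal_prob; apply: eq_integral => x _.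
by rewrite !normal_pdfE// /normal_fun /normal_peak E.
Qed.

End GaussianSpace.

(** * Independence of uncorrelated elements of the Gaussian space *)

Section Independence.
Context {d : measure_display} {T : measurableType d} {R : realType}.
Variable P : probability T R.
Variable X : set (measurableTypeR R) -> {RV P >-> R}.
Hypothesis hX : gaussian_information_model X.

(** After [cosM], both U + S and U - S lie in the Gaussian space and have variance Var U + Var S, so
    a common exponential factor comes out and splits into the two factors of the right side. *)
Lemma orthogonal_cos (U S : T -> R) (theta eta : R) :
  gaussian_space X U -> gaussian_space X S -> inner P U S = 0 ->
  \int[P]_w (cos (U w + theta) * cos (S w + eta)) =
  \int[P]_w cos (U w + theta) * \int[P]_w cos (S w + eta).
Proof.
move=> hU hS US.
have hp : gaussian_space X (fun w => U w + S w) by exact: gaussian_spaceD.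
have hn : gaussian_space X (fun w => U w + (-1) * S w).
  by apply: gaussian_spaceD => //; exact: gaussian_spaceZ.
have bc (V : T -> R) th : gaussian_space X V ->
    P.-integrable setT (EFin \o (fun w => cos (V w + th))).
  move=> hV; apply: bounded_measurable_integrable => //.
  apply: bounded_measurable_cos; apply: measurable_funD => //.
  exact: gaussian_space_measurable hV.
have ip (c : R) : c ^+ 2 = 1 -> inner P (fun w => U w + c * S w) (fun w => U w + c * S w) =
    inner P U U + inner P S S.
  move=> c1; have hc : gaussian_space X (fun w => c * S w) by exact: gaussian_spaceZ.
  have hUc : gaussian_space X (fun w => U w + c * S w) by exact: gaussian_spaceD.
  rewrite (innerDr hX)// (innerC _ _ U) (innerDr hX)// (innerZr hX)// US.
  rewrite (innerZr hX)// (innerC _ _ S) (innerDr hX)// (innerZr hX)//.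
  rewrite (innerC _ S U) US mulr0 addr0 add0r mulrA -expr2 c1 mul1r.
  by [].
transitivity (2^-1 * (\int[P]_w (cos ((U w + S w) + (theta + eta)) +
    cos ((U w + (-1) * S w) + (theta - eta))))).
  rewrite -RintegralZl//; last first.
    by apply: integrableRD; exact: bc.
  apply: eq_Rintegral => w _; rewrite cosM; congr (_ * (cos _ + cos _)); ring.
rewrite RintegralD//; [|exact: bc|exact: bc].
rewrite !(gaussian_space_cos hX)//.
have := ip 1 (expr1n _ _).
rewrite (_ : (fun w => U w + 1 * S w) = (fun w => U w + S w)); last first.
  by apply/funext => w; rewrite mul1r.
move=> ->; rewrite ip ?sqrrN ?expr1n//.
have -> : expR (- (inner P U U + inner P S S) / 2) =
    expR (- inner P U U / 2) * expR (- inner P S S / 2).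
  by rewrite -expRD; congr expR; ring.
by rewrite cosD cosB; field.
Qed.

(** Fourier uniqueness is used twice. First, with t and th fixed, the weight cos (t U + th) minus
    its mean integrates to zero over A, by uniqueness in V. This says that the weight 1_A - P(A) has
    vanishing cosine integrals against U, and uniqueness in U then gives the claim for every D. *)
Lemma orthogonal_independent (n : nat) (U : T -> R) (V : 'I_n -> T -> R)
    (A : set T) (D : set R) :
  gaussian_space X U -> (forall i, gaussian_space X (V i)) ->
  (forall i, inner P U (V i) = 0) ->
  g_sigma_preimage V A -> measurable A -> measurable D ->
  P (A `&` U @^-1` D) = (P A * P (U @^-1` D))%E.
Proof.
move=> hU hV UV sA mA mD.
have mU := gaussian_space_measurable hU.
have mV i := gaussian_space_measurable (hV i).
have mUD : measurable (U @^-1` D) by rewrite -[_ @^-1` _]setTI; exact: mU.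
have mtU t th : measurable_fun setT (fun w => t * U w + th).
  by apply: measurable_funD => //; exact: measurable_funM.
pose E t th := \int[P]_w cos (t * U w + th).
have bE t th : bounded_measurable (fun w => cos (t * U w + th) - E t th).
  apply: bounded_measurableB; last exact: bounded_measurable_cst.
  exact: bounded_measurable_cos.
have hA t th : (\int[P]_(w in A) (cos (t * U w + th) - E t th)%:E = 0)%E.
  apply: (fourier_g_sigma_preimage mV (bE t th)) => // s eta.
  have hS : gaussian_space X (fun w => \sum_(i < n) s i * V i w).
    exact: gaussian_space_sum.
  have mS : measurable_fun setT (fun w => \sum_(i < n) s i * V i w + eta).
    by apply: measurable_funD => //; exact: gaussian_space_measurable hS.
  have htU : gaussian_space X (fun w => t * U w) by exact: gaussian_spaceZ.
  under eq_Rintegral do rewrite mulrBl.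
  rewrite RintegralB//; last 2 first.
  - apply: bounded_measurable_integrable => //; apply: bounded_measurableM;
      exact: bounded_measurable_cos.
  - apply: bounded_measurable_integrable => //; apply: bounded_measurableM.
      exact: bounded_measurable_cst.
    exact: bounded_measurable_cos.
  rewrite RintegralZl//; last first.
    by apply: bounded_measurable_integrable => //; exact: bounded_measurable_cos.
  rewrite (orthogonal_cos _ _ htU hS) ?subrr//.
  rewrite innerC (innerZr hX)// innerC (inner_sumr hX)//.
  by rewrite big1 ?mulr0// => i _; rewrite UV mulr0.
pose pA := fine (P A).
have pAE : P A = pA%:E by rewrite /pA fineK// fin_num_measure.
have bG : bounded_measurable (fun w => \1_A w - pA : R).
  apply: bounded_measurableB; last exact: bounded_measurable_cst.
  exact: bounded_measurable_indic.
have : (\int[P]_(w in U @^-1` D) (\1_A w - pA)%:E = 0)%E.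
  apply: (fourier_uniqueness mU bG) => // t th.
  have bc : bounded_measurable (fun w => cos (t * U w + th)).
    exact: bounded_measurable_cos.
  have : \int[P]_(w in A) (cos (t * U w + th) - E t th) = 0.
    by rewrite /Rintegral hA.
  rewrite RintegralB//; last 2 first.
  - exact: bounded_measurable_integrable.
  - by apply: bounded_measurable_integrable => //; exact: bounded_measurable_cst.
  rewrite Rintegral_cst// -/pA -Rintegral_indicM// => e.
  under eq_Rintegral do rewrite mulrBl.
  rewrite RintegralB//; last 2 first.
  - apply: bounded_measurable_integrable => //; apply: bounded_measurableM => //.
    exact: bounded_measurable_indic.
  - apply: bounded_measurable_integrable => //; apply: bounded_measurableM => //.
    exact: bounded_measurable_cst.
  rewrite RintegralZl//; last exact: bounded_measurable_integrable.
  under eq_Rintegral do rewrite mulrC.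
  by rewrite -/(E t th) [X in _ - X]mulrC.
under eq_integral do rewrite EFinB.
rewrite integralB//; last 2 first.
- by apply: bounded_measurable_integrable => //; exact: bounded_measurable_indic.
- by apply: bounded_measurable_integrable => //; exact: bounded_measurable_cst.
rewrite integral_indic// integral_cst//= -pAE => /eqP.
rewrite sube_eq ?add0e; last 2 first.
- by rewrite fin_num_measure//; exact: measurableI.
- by rewrite pAE fin_num_adde_defl// fin_numM// fin_num_measure.
by move=> /eqP.
Qed.

End Independence.

(** * The standard normal distribution function *)

Section PhiProperties.
Context {R : realType}.
Notation mu := (@lebesgue_measure R).

Lemma normal_prob_itv_gt0 (m s x y : R) : s != 0 -> x < y ->
  (0 < normal_prob m s `]x, y]%classic)%E.
Proof.
move=> s0 xy; rewrite lt0e measure_ge0 andbT; apply/eqP => e.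
have mI : measurable `]x, y]%classic by exact: measurable_itv.
have : (\int[mu]_(z in `]x, y]) `|(normal_pdf m s z)%:E| = 0)%E.
  rewrite -[RHS]e; apply: eq_integral => z _.
  by rewrite gee0_abs// lee_fin normal_pdf_ge0.
move=> /ae_eq_integral_abs; case.
- exact: mI.
- by apply/measurable_EFinP/measurable_funTS; exact: measurable_normal_pdf.
move=> N [mN N0 sub].
have : (mu `]x, y]%classic <= mu N)%E.
  apply: le_measure; rewrite ?inE//.
  move=> z xz; apply: sub => /= /(_ xz) [].
  by apply/eqP; rewrite gt_eqF// normal_pdfE// mulr_gt0 ?expR_gt0// normal_peak_gt0.
rewrite N0 lebesgue_measure_itv/= lte_fin xy -EFinD lee_fin.
by rewrite leNgt subr_gt0 xy.
Qed.

Lemma Phi_ray (x : R) : normal_prob 0 1 `]-oo, x]%classic = (Phi x)%:E.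
Proof. by rewrite /Phi fineK// fin_num_measure//; exact: measurable_itv. Qed.

Lemma Phi_split (x y : R) : x <= y ->
  (Phi y)%:E = ((Phi x)%:E + normal_prob 0 1 `]x, y]%classic)%E.
Proof.
move=> xy; rewrite -!Phi_ray -measureU.
- by congr (normal_prob 0 1 _); rewrite -itv_bndbnd_setU.
- exact: measurable_itv.
- exact: measurable_itv.
- apply/seteqP; split => z //=; rewrite !in_itv/= => -[zx /andP[xz _]].
  by move: (lt_le_trans xz zx); rewrite ltxx.
Qed.

Lemma Phi_lt (x y : R) : x < y -> Phi x < Phi y.
Proof.
move=> xy; rewrite -lte_fin (Phi_split (ltW xy)) lteDl//.
by apply: normal_prob_itv_gt0 => //; rewrite oner_neq0.
Qed.

Lemma Phi_ltE (x y : R) : (Phi x < Phi y) = (x < y).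
Proof.
apply/idP/idP; last exact: Phi_lt.
by apply: contraTT; rewrite -!leNgt le_eqVlt => /predU1P[->//|/Phi_lt/ltW].
Qed.

(** At z = 0, [normal_prob_upper_ray] says that the ray and its complement have the same mass. *)
Lemma Phi0 : Phi 0 = 1 / 2 :> R.
Proof.
have m0 : measurable (`]-oo, 0]%classic : set R) by exact: measurable_itv.
have h1 : normal_prob 0 1 (~` `]-oo, (0 : R)]%classic) = (Phi 0)%:E.
  have := normal_prob_upper_ray 0 (@ltr01 R).
  rewrite mul0r Phi_ray => <-; congr (normal_prob 0 1 _).
  by apply/seteqP; split => x /=; rewrite in_itv/= add0r ltNge => /negP.
have h2 : normal_prob 0 1 (~` `]-oo, (0 : R)]%classic) = (1 - (Phi 0)%:E)%E.
  rewrite -Phi_ray; exact: (probability_setC (normal_prob 0 1) m0).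
by move: h1; rewrite h2 -EFinB => -[]; lra.
Qed.

Lemma Phi_le (x y : R) : (Phi x <= Phi y) = (x <= y).
Proof. by rewrite !leNgt Phi_ltE. Qed.

Lemma Phi_le_half (x : R) : (Phi x <= 1 / 2) = (x <= 0).
Proof. by rewrite -Phi0 Phi_le. Qed.

Lemma Phi_ge_half (x : R) : (1 / 2 <= Phi x) = (0 <= x).
Proof. by rewrite -Phi0 Phi_le. Qed.

Lemma Phi_inj : injective (@Phi R).
Proof.
move=> x y; have [/Phi_lt + e|/Phi_lt + e|//] := ltgtP x y;
  by rewrite e ltxx.
Qed.

Lemma Phi_gt0 (x : R) : 0 < Phi x.
Proof.
apply: le_lt_trans (Phi_lt (_ : x - 1 < x)); last by rewrite gtrBl.
by rewrite -lee_fin -Phi_ray measure_ge0.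
Qed.

Lemma Phi_lt1 (x : R) : Phi x < 1.
Proof.
apply: lt_le_trans (Phi_lt (_ : x < x + 1)) _; first by rewrite ltrDl.
by rewrite -lee_fin -Phi_ray probability_le1//; exact: measurable_itv.
Qed.

(** The maximum [normal_peak 1] of the density is a Lipschitz constant. *)
Lemma Phi_continuous : continuous (@Phi R).
Proof.
have one0 : (1 : R) != 0 by exact: oner_neq0.
pose K := normal_peak (1 : R).
have K0 : 0 < K by exact: normal_peak_gt0.
have lip (x y : R) : x <= y -> Phi y - Phi x <= K * (y - x).
  move=> xy; rewrite lerBlDl -lee_fin (Phi_split xy) EFinD leeD2l//.
  apply: (@le_trans _ _ (\int[mu]_(z in `]x, y]) (cst K%:E z))%E).
    apply: ge0_le_integral => //=.
    - by move=> z _; rewrite lee_fin normal_pdf_ge0.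
    - by apply/measurable_EFinP/measurable_funTS; exact: measurable_normal_pdf.
    - by move=> z _; rewrite lee_fin normal_pdf_ub.
  rewrite integral_cst// [leLHS](_ : _ = K%:E * mu `]x, y]%classic)%E//.
  rewrite lebesgue_measure_itv/= lte_fin EFinM.
  case: ltP => [_|yx]; first by rewrite -EFinD.
  by rewrite mule0 lee_fin mulr_ge0 ?(ltW K0)// subr_ge0.
have lip2 (x y : R) : `|Phi x - Phi y| <= K * `|x - y|.
  have [xy|/ltW yx] := leP x y.
    rewrite distrC (distrC x) !ger0_norm ?subr_ge0//; first exact: lip.
    by move: xy; rewrite le_eqVlt => /predU1P[->//|/Phi_lt/ltW].
  rewrite !ger0_norm ?subr_ge0//; first exact: lip.
  by move: yx; rewrite le_eqVlt => /predU1P[->//|/Phi_lt/ltW].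
move=> x; apply/cvgrPdist_lt => e e0.
near=> y.
rewrite (le_lt_trans (lip2 _ _))// mulrC -ltr_pdivlMr//.
near: y; apply: (@cvgr_dist_lt _ _ _ (nbhs x) _ id x); first exact: cvg_id.
by rewrite divr_gt0.
Unshelve. all: by end_near. Qed.

Lemma measurable_Phi : measurable_fun setT (@Phi R).
Proof. exact: continuous_measurable_fun Phi_continuous. Qed.

Lemma PhiK : cancel (@Phi R) (@probit R).
Proof.
move=> x; rewrite /probit; case: xgetP => [y _ /Phi_inj //|/(_ x)] h.
by case: h.
Qed.

(** Needed to rebuild the Y_i measurably from the forecasts. On the range of [Phi], which is an
    interval, [probit] is the increasing inverse; off the range it is 0, which accounts for the
    second set in the preimage of a ray. *)
Lemma measurable_probit : measurable_fun setT (@probit R).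
Proof.
have mrange : measurable (range (@Phi R)).
  apply: is_interval_measurable; apply/connected_intervalP.
  apply: connected_continuous_connected; last first.
    exact/continuous_subspaceT/Phi_continuous.
  by apply/connected_intervalP => x y z.
have probitN (u : R) : ~ range (@Phi R) u -> probit u = 0.
  move=> nu; rewrite /probit; case: xgetP => // y _ yu; exfalso; apply: nu.
  by exists y.
apply: (measurability _ (RGenInftyO.measurableE R)) => //.
move=> _ [_ [c ->] <-]; rewrite setTI.
have -> : @probit R @^-1` `]-oo, c[%classic =
    (range (@Phi R) `&` `]-oo, Phi c[%classic) `|`
    (~` range (@Phi R) `&` [set u | 0 < c]).
  apply/seteqP; split => u /=.
    have [[x _ <-]|nu] := pselect (range (@Phi R) u).
      rewrite PhiK !in_itv/= => xc; left; split; first by exists x.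
      by rewrite Phi_ltE.
    by rewrite probitN// in_itv/= => c0; right.
  case=> [[[x _ <-]]|[nu c0]]; first by rewrite PhiK !in_itv/= Phi_ltE.
  by rewrite probitN// in_itv.
apply: measurableU; apply: measurableI => //; first exact: measurableC.
case: (ltP 0 c) => c0.
  by rewrite (_ : [set u | _] = setT)//; apply/seteqP; split.
by rewrite (_ : [set u | _] = set0)//; apply/seteqP; split.
Qed.

End PhiProperties.

(** * Conditional probability of the target event *)

Section RestrictedImage.
Context {d1 d2 : measure_display} {T : measurableType d1} {Y : measurableType d2}
  {R : realType}.
Variables (P : probability T R) (C : set T) (Z : T -> Y).

(** The law of Z on the event C, not normalized. The two measurability proofs are arguments so that
    the measure structure can be attached to this term. *)
Definition restricted_image (mC : measurable C) (mZ : measurable_fun setT Z)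
  (A : set Y) : \bar R := P (Z @^-1` A `&` C).

Variables (mC : measurable C) (mZ : measurable_fun setT Z).
Local Notation nu := (restricted_image mC mZ).

Let mpre (A : set Y) : measurable A -> measurable (Z @^-1` A `&` C).
Proof. by move=> mA; apply: measurableI => //; rewrite -[_ @^-1` _]setTI; exact: mZ. Qed.

Let restricted_image0 : nu set0 = 0%E.
Proof. by rewrite /restricted_image preimage_set0 set0I measure0. Qed.

Let restricted_image_ge0 A : (0 <= nu A)%E. Proof. exact: measure_ge0. Qed.

Let restricted_image_sigma_additive : semi_sigma_additive nu.
Proof.
move=> F mF tF mUF; rewrite /restricted_image preimage_bigcup setI_bigcupl.
apply: measure_semi_sigma_additive.
- by move=> n; exact: mpre.
- apply/trivIsetP => /= i j _ _ ij; rewrite setIACA setIid -preimage_setI.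
  by move/trivIsetP : tF => /(_ _ _ _ _ ij) ->//; rewrite preimage_set0 set0I.
- by rewrite -setI_bigcupl -preimage_bigcup; exact: mpre.
Qed.

HB.instance Definition _ := isMeasure.Build _ _ _ nu
  restricted_image0 restricted_image_ge0 restricted_image_sigma_additive.

Let restricted_image_fin : fin_num_fun nu.
Proof. by move=> A mA; rewrite fin_num_measure//; exact: mpre. Qed.

HB.instance Definition _ := @Measure_isFinite.Build _ _ _ nu restricted_image_fin.

Lemma ge0_integral_restricted_image (f : Y -> \bar R) : measurable_fun setT f ->
  (forall y, 0 <= f y)%E -> (\int[nu]_y f y = \int[P]_(w in C) f (Z w))%E.
Proof.
move=> mf f0.
rewrite (@ge0_integral_image _ _ _ _ _ Z mZ (mrestr P mC) nu)//.
have mfZ : measurable_fun setT (fun w => f (Z w)) by exact: measurableT_comp.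
rewrite -(setUv C) ge0_integral_setU//.
- rewrite [X in (_ + X)%E](_ : _ = 0)%E ?adde0.
    apply: eq_measure_integral => A mA AC.
    by rewrite -[in RHS](setIidl AC).
  rewrite (@eq_measure_integral _ _ _ _ mzero).
    by rewrite integral_measure_zero.
  move=> A mA AC; have AC0 : A `&` C = set0 by apply/seteqP; split => x // [/AC].
  exact: etrans (congr1 P AC0) (measure0 P).
- exact: measurableC.
- by rewrite setUv.
- exact/disj_setPCl.
Qed.

End RestrictedImage.

Section Shift.
Context {d : measure_display} {T : measurableType d} {R : realType}.
Variable P : probability T R.

(** By hypothesis the law of (Z, W) on C is the product of the law of Z on C with the normal law of
    deviation s. The section at z of the set of pairs with positive sum has mass Phi(z / s). *)
Lemma independent_normal_shift (C : set T) (Z W : T -> R) (s : R) :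
  measurable C -> measurable_fun setT Z -> measurable_fun setT W -> 0 < s ->
  (forall A D : set R, measurable A -> measurable D ->
    P ((Z @^-1` A `&` C) `&` W @^-1` D) = (P (Z @^-1` A `&` C) * normal_prob 0 s D)%E) ->
  P (C `&` [set w | 0 < Z w + W w]) = (\int[P]_(w in C) (Phi (Z w / s))%:E)%E.
Proof.
move=> mC mZ mW s0 ind.
pose RR := measurableTypeR R.
have mZ' : @measurable_fun _ _ T RR setT Z := mZ.
have mW' : @measurable_fun _ _ T RR setT W := mW.
pose m1 := restricted_image P mC mZ'.
pose phi w : RR * RR := (Z w, W w).
have mphi : measurable_fun setT phi by exact/measurable_fun_pairP.
pose m' := restricted_image P mC mphi.
pose B := [set z : RR * RR | (0 : R) < (z.1 : R) + (z.2 : R)].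
have mB : measurable B.
  have m1' : @measurable_fun _ _ (RR * RR)%type R setT fst := @measurable_fst _ _ RR RR.
  have m2' : @measurable_fun _ _ (RR * RR)%type R setT snd := @measurable_snd _ _ RR RR.
  have := measurable_funD m1' m2'.
  move=> /(_ measurableT `]0, +oo[%classic (measurable_itv _)); rewrite setTI.
  by congr measurable; apply/seteqP; split => z /=; rewrite in_itv/= andbT.
have -> : P (C `&` [set w | 0 < Z w + W w]) = m' B.
  by rewrite /m' /restricted_image setIC.
have prodE : forall D, measurable D -> (m1 \x normal_prob 0 s)%E D = m' D.
  apply: product_measure_unique => A D mA mD.
  have := ind A D mA mD; rewrite /m' /m1 /restricted_image => <-.
  by congr (P _); apply/seteqP; split => w /=; [move=> [[? ?] ?]|move=> [[? ?] ?]].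
rewrite -(prodE _ mB).
rewrite /product_measure1.
rewrite -(@ge0_integral_restricted_image _ _ _ RR _ P C Z mC mZ' (fun z : RR => (Phi (z / s))%:E)).
- apply: eq_integral => z _ /=; rewrite -Phi_ray -normal_prob_upper_ray//.
  congr (normal_prob 0 s _); apply/seteqP; split => x /=; rewrite /xsection /= ?inE//.
- apply/measurable_EFinP; apply: (measurableT_comp measurable_Phi).
  exact: measurable_funM.
- by move=> y; rewrite -Phi_ray.
Qed.
End Shift.

(** * Generated sigma-algebras and uniqueness of conditional expectations *)

Section SigmaTools.
Context {d : measure_display} {T : measurableType d} {R : realType}.

Lemma g_sigma_preimage_generator (n : nat) (V : 'I_n -> T -> R) (i : 'I_n) (D : set R) :
  measurable D -> g_sigma_preimage V (V i @^-1` D).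
Proof.
move=> mD; apply: sub_sigma_algebra; rewrite (bigD1 i)//=; left.
by exists D => //; rewrite setTI.
Qed.

Lemma g_sigma_preimage_sub (n : nat) (V : 'I_n -> T -> R) (H : set (set T)) :
  sigma_algebra setT H ->
  (forall i (D : set R), measurable D -> H (V i @^-1` D)) ->
  g_sigma_preimage V `<=` H.
Proof.
move=> sH hV; apply: smallest_sub => //.
apply: (@big_ind _ (fun S : set (set T) => S `<=` H)) => //.
  by move=> S1 S2 h1 h2 x [/h1|/h2].
by move=> i _ _ [D mD <-]; rewrite setTI; exact: hV.
Qed.

Lemma g_sigma_preimage_measurable (n : nat) (V : 'I_n -> T -> R) :
  (forall i, measurable_fun setT (V i)) -> g_sigma_preimage V `<=` measurable.
Proof.
move=> mV; apply: g_sigma_preimage_sub; first exact: sigma_algebra_measurable.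
by move=> i D mD; rewrite -[_ @^-1` _]setTI; exact: mV.
Qed.

Variable P : probability T R.

(** The sets where g - h is nonnegative and where it is negative both lie in G, so |g - h|
    integrates to zero over each of them. G is a bare set system, and measurability is therefore
    stated for the difference directly. *)
Lemma conditional_expectation_unique (G : set (set T)) (g h : T -> R) :
  G `<=` measurable ->
  P.-integrable setT (EFin \o g) -> P.-integrable setT (EFin \o h) ->
  (forall D : set R, measurable D -> G ((fun w => g w - h w) @^-1` D)) ->
  (forall C, G C -> (\int[P]_(w in C) (g w)%:E = \int[P]_(w in C) (h w)%:E)%E) ->
  \forall w \ae P, g w = h w.
Proof.
move=> Gm ig ih Gu eq; pose u w := g w - h w.
have mg : measurable_fun setT g by apply/measurable_EFinP; exact: measurable_int ig.
have mh : measurable_fun setT h by apply/measurable_EFinP; exact: measurable_int ih.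
have mu : measurable_fun setT u by exact: measurable_funB.
have u0 C : G C -> (\int[P]_(w in C) (u w)%:E = 0)%E.
  move=> GC; have mC := Gm _ GC.
  have iC f : P.-integrable setT (EFin \o f) -> P.-integrable C (EFin \o f).
    by apply: integrableS.
  under eq_integral do rewrite EFinB.
  rewrite integralB//; [|exact: iC ig|exact: iC ih].
  by rewrite eq// subee// integrable_fin_num//; exact: iC ih.
pose C1 := u @^-1` `[0, +oo[%classic; pose C2 := u @^-1` `]-oo, 0[%classic.
have GC1 : G C1 by apply: Gu; exact: measurable_itv.
have GC2 : G C2 by apply: Gu; exact: measurable_itv.
have mC1 := Gm _ GC1; have mC2 := Gm _ GC2.
have C12 : C1 `|` C2 = setT.
  apply/seteqP; split => // w _; rewrite /C1 /C2 /= !in_itv/= andbT.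
  by case: (leP 0 (u w)) => ?; [left|right].
have mau : measurable_fun setT (fun w => `|(u w)%:E|%E).
  by apply: measurableT_comp => //; exact/measurable_EFinP.
have : (\int[P]_w `|(u w)%:E| = 0)%E.
  rewrite -C12 ge0_integral_setU//; last 2 first.
  - by rewrite C12.
  - apply/disj_setPS => w []; rewrite /C1 /C2 /= !in_itv/= andbT => a b.
    by move: (le_lt_trans a b); rewrite ltxx.
  rewrite (_ : (\int[P]_(w in C1) _ = 0)%E); last first.
    rewrite -[RHS](u0 _ GC1); apply: eq_integral => w; rewrite inE /C1 /= in_itv/= andbT => uw.
    by rewrite ger0_norm.
  rewrite add0e -[RHS]oppe0 -[in RHS](u0 _ GC2) -integralN/=.
    apply: eq_integral => w; rewrite inE /C2 /= in_itv/= => uw.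
    by rewrite ltr0_norm.
  apply: integrable_add_def => //.
  apply: (@integrableS _ _ _ P setT) => //.
  by have := integrableB measurableT ig ih; apply: eq_integrable.
move/ae_eq_integral_abs => /(_ measurableT) [|N [mN N0 sub]].
  exact/measurable_EFinP.
exists N; split => // w /= nw; apply: sub => /= /(_ I) [] /eqP.
by rewrite subr_eq0 => /eqP.
Qed.

End SigmaTools.

Section Conditional.
Context {d : measure_display} {T : measurableType d} {R : realType}.
Variable P : probability T R.
Variable X : set (measurableTypeR R) -> {RV P >-> R}.
Hypothesis hX : gaussian_information_model X.

Lemma borel_unit_S : borel_subset_S (@unit_S R).
Proof. by split => //; exact: measurable_itv. Qed.

Lemma measurable_target_event : measurable (target_event X).
Proof.
have mX : measurable_fun setT (X unit_S : T -> R) by exact: measurable_funP.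
have := mX measurableT `]0, +oo[%classic (measurable_itv _).
by rewrite setTI; congr measurable; apply/seteqP; split => w /=; rewrite in_itv/= andbT.
Qed.

(** The covariance hypothesis says that Z is the projection of X_S on the span of the X_(B j), so
    the residual W is independent of their sigma-algebra, and its variance is 1 - Cov(X_S, Z) = 1 -
    v. With general coefficients this covers a single forecaster and the aggregator alike. *)
Lemma gaussian_conditional (n : nat) (B : 'I_n -> set (measurableTypeR R))
    (c : 'I_n -> R) (v : R) (C : set T) :
  let Z w := \sum_(i < n) c i * X (B i) w in
  (forall i, borel_subset_S (B i)) ->
  (forall j, inner P Z (X (B j)) = inner P (X unit_S) (X (B j))) ->
  inner P (X unit_S) Z = v -> v < 1 ->
  g_sigma_preimage (fun i => X (B i) : T -> R) C ->
  P (C `&` target_event X) = (\int[P]_(w in C) (Phi (Z w / Num.sqrt (1 - v)))%:E)%E.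
Proof.
move=> Z mB ZV ZS v1 sC; set s := Num.sqrt (1 - v).
have s0 : 0 < s by rewrite sqrtr_gt0 subr_gt0.
have hS : gaussian_space X (X unit_S) by apply: gaussian_space_X; exact: borel_unit_S.
have hV i : gaussian_space X (X (B i)) by exact: gaussian_space_X.
have hZ : gaussian_space X Z by exact: gaussian_space_sum.
pose W w := X unit_S w + (-1) * Z w.
have hnZ : gaussian_space X (fun w => (-1) * Z w) by exact: gaussian_spaceZ.
have hW : gaussian_space X W by exact: gaussian_spaceD.
have WV i : inner P W (X (B i)) = 0.
  rewrite innerC (innerDr hX)// (innerZr hX)// innerC (innerC _ _ Z) ZV.
  by rewrite mulN1r subrr.
have WZ : inner P W Z = 0.
  by rewrite (inner_sumr hX)// big1// => i _; rewrite WV mulr0.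
have SS : inner P (X unit_S) (X unit_S) = 1.
  apply: EFin_inj; rewrite (inner_X hX)//; [|exact: borel_unit_S|exact: borel_unit_S].
  by rewrite setIid /unit_S lebesgue_measure_itv/= lte_fin ltr01 oppr0 adde0.
have WW : inner P W W = s ^+ 2.
  rewrite (innerDr hX)// (innerZr hX)// WZ mulr0 addr0 innerC (innerDr hX)//.
  by rewrite (innerZr hX)// SS ZS mulN1r sqr_sqrtr// subr_ge0 ltW.
have mV i : measurable_fun setT (X (B i) : T -> R) by exact: measurable_funP.
have mC := g_sigma_preimage_measurable mV sC.
rewrite (_ : target_event X = [set w | 0 < Z w + W w]); last first.
  apply/seteqP; split => w; rewrite /target_event /W /=;
    by rewrite (_ : Z w + _ = X unit_S w)//; ring.
apply: independent_normal_shift => //.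
- exact: gaussian_space_measurable hZ.
- exact: gaussian_space_measurable hW.
- move=> A D mA mD.
  have sZ : g_sigma_preimage (fun i => X (B i) : T -> R) (Z @^-1` A `&` C).
    pose K := \big[setU/set0]_(i < n) preimage_set_system setT (X (B i) : T -> R) measurable.
    (* T with the generated sigma-algebra: measurability with respect to [TK] is membership of
       preimages in [g_sigma_preimage]. *)
    pose TK := g_sigma_algebraType K.
    have mZK : @measurable_fun _ _ TK R setT Z.
      apply: (@measurable_sum _ TK) => i; apply: measurable_funM => //.
      move=> _ E mE; rewrite setTI; exact: (g_sigma_preimage_generator (V := fun i => X (B i) : T -> R)).
    have h1 : @measurable _ TK (Z @^-1` A) by rewrite -[_ @^-1` _]setTI; exact: mZK.
    have h2 : @measurable _ TK C by [].
    exact: (@measurableI _ TK _ _ h1 h2).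
  rewrite (orthogonal_independent hX hW hV WV sZ)//.
    by rewrite (gaussian_space_normal hX hW WW s0).
  exact: (g_sigma_preimage_measurable mV sZ).
Qed.

End Conditional.

(** * Forecasts and the revealed aggregator *)

Section Aggregation.
Context {d : measure_display} {T : measurableType d} {R : realType}.
Variable P : probability T R.
Variable X : set (measurableTypeR R) -> {RV P >-> R}.
Hypothesis hX : gaussian_information_model X.

Lemma bounded_measurable_Phi (f : T -> R) : measurable_fun setT f ->
  bounded_measurable (fun w => Phi (f w)).
Proof.
move=> mf; split; first exact: (measurableT_comp measurable_Phi mf).
by exists 1 => w; rewrite ger0_norm ltW// ?Phi_gt0 ?Phi_lt1.
Qed.

Lemma integral_target_event (C : set T) : measurable C ->
  (\int[P]_(w in C) ((\1_(target_event X) : T -> R) w)%:E = P (C `&` target_event X))%E.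
Proof.
move=> mC; rewrite integral_indic//; last exact: measurable_target_event.
by rewrite setIC.
Qed.

(** The case of one set with coefficient 1 in [gaussian_conditional]: X_B is the projection of X_S,
    because Cov(X_S, X_B) = |B| = Var X_B. *)
Lemma forecast_ae (B : set (measurableTypeR R)) (delta : R) (p : T -> R) :
  borel_subset_S B -> lebesgue_measure B = delta%:E -> delta < 1 ->
  is_forecast X B p ->
  \forall w \ae P, p w = Phi (X B w / Num.sqrt (1 - delta)).
Proof.
move=> mB Bd d1 [pm pint peq].
have mY : measurable_fun setT (X B : T -> R) by exact: measurable_funP.
have mq : measurable_fun setT (fun w => X B w / Num.sqrt (1 - delta)).
  exact: measurable_funM.
apply: (conditional_expectation_unique (G := g_sigma_algebra_preimage (X B))).
- by move=> _ [D mD <-]; exact: mY.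
- exact: pint.
- by apply: bounded_measurable_integrable => //; exact: bounded_measurable_Phi.
- pose TK := g_sigma_algebra_preimageType (X B).
  have mYK : @measurable_fun _ _ TK R setT (X B).
    by move=> _ D mD; rewrite setTI; exists D => //; rewrite setTI.
  have mpK : @measurable_fun _ _ TK R setT p.
    by move=> _ D mD; rewrite setTI; exact: pm.
  have mqK : @measurable_fun _ _ TK R setT (fun w => Phi (X B w / Num.sqrt (1 - delta))).
    apply: (measurableT_comp measurable_Phi).
    exact: (@measurable_funM _ TK).
  have muK := @measurable_funB _ TK _ _ _ _ mpK mqK.
  by move=> D mD; have := muK measurableT D mD; rewrite setTI.
- move=> C GC; have [D mD CD] := GC.
  have mC : measurable C by rewrite -CD; exact: mY.
  rewrite peq// integral_target_event//.
  have Y1 : (fun w => \sum_(i < 1) 1 * X B w) = X B.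
    by apply/funext => w; rewrite big_ord1 mul1r.
  have YS : inner P (X unit_S) (X B) = delta.
    apply: EFin_inj; rewrite (inner_X hX)//; last exact: borel_unit_S.
    by rewrite setIidr//; case: mB.
  have YY : inner P (X B) (X B) = delta.
    by apply: EFin_inj; rewrite (inner_X hX)// setIid.
  have sC : g_sigma_preimage (fun _ : 'I_1 => X B : T -> R) C.
    rewrite -CD setTI.
    exact: (g_sigma_preimage_generator (V := fun _ : 'I_1 => X B : T -> R) ord0).
  have := @gaussian_conditional _ _ _ P X hX 1 (fun=> B) (fun=> 1) delta C (fun=> mB).
  rewrite /= Y1 => h; rewrite (h _ YS d1 sC); last by move=> _; rewrite YY YS.
  by apply: eq_integral => w _; rewrite big_ord1 mul1r.
Qed.

(** The natural candidate is measurable for sigma(X_(B i)), whereas uniqueness asks for sigma(p).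
    Replacing each X_(B i) by k probit(p_i) changes it only on a null set and makes it exactly
    sigma(p)-measurable. Conversely sigma(p) is contained in sigma(X_(B i)) without exception, by
    the measurability clause of the forecasts, so [gaussian_conditional] applies to its events. *)
Lemma revealed_ae (n : nat) (B : 'I_n -> set (measurableTypeR R))
    (c : 'I_n -> R) (v k : R) (p : 'I_n -> T -> R) (q : T -> R) :
  let Z w := \sum_(i < n) c i * X (B i) w in
  (forall i, borel_subset_S (B i)) ->
  (forall j, inner P Z (X (B j)) = inner P (X unit_S) (X (B j))) ->
  inner P (X unit_S) Z = v -> v < 1 -> k != 0 ->
  (forall i, is_forecast X (B i) (p i)) ->
  (forall i, \forall w \ae P, p i w = Phi (X (B i) w / k)) ->
  is_revealed_aggregator X p q ->
  \forall w \ae P, q w = Phi (Z w / Num.sqrt (1 - v)).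
Proof.
move=> Z mB ZV ZS v1 k0 fp pY [qm qint qeq].
pose Z' w := \sum_(i < n) c i * (k * probit (p i w)).
have pYall : \forall w \ae P, forall i, p i w = Phi (X (B i) w / k).
  exact: filter_forall.
have ZZ' : \forall w \ae P, Z' w = Z w.
  apply: filterS pYall => w h; apply: eq_bigr => i _; rewrite h PhiK.
  by congr (_ * _); rewrite mulrC divfK.
have mV i : measurable_fun setT (X (B i) : T -> R) by exact: measurable_funP.
have mp i : measurable_fun setT (p i).
  by have [_ /measurable_int/measurable_EFinP + _] := fp i.
have mZ : measurable_fun setT Z.
  by apply: measurable_sum => i; exact: measurable_funM.
have mZ' : measurable_fun setT Z'.
  apply: measurable_sum => i; apply: measurable_funM => //; apply: measurable_funM => //.
  exact: (measurableT_comp measurable_probit).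
have mq (f : T -> R) : measurable_fun setT f ->
    measurable_fun setT (fun w => f w / Num.sqrt (1 - v)).
  by move=> mf; exact: measurable_funM.
have Gm := g_sigma_preimage_measurable mp.
have Gsub : g_sigma_preimage p `<=` g_sigma_preimage (fun i => X (B i) : T -> R).
  apply: g_sigma_preimage_sub; first exact: smallest_sigma_algebra.
  move=> i D mD; have [/(_ _ mD) [E mE <-] _ _] := fp i; rewrite setTI.
  exact: (g_sigma_preimage_generator (V := fun i => X (B i) : T -> R)).
suff h : \forall w \ae P, q w = Phi (Z' w / Num.sqrt (1 - v)).
  by apply: filterS2 h ZZ' => w -> ->.
apply: (conditional_expectation_unique Gm) => //.
- apply: bounded_measurable_integrable => //; apply: bounded_measurable_Phi.
  exact: mq.
- pose K := \big[setU/set0]_(i < n) preimage_set_system setT (p i) measurable.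
  pose TK := g_sigma_algebraType K.
  have mpK i : @measurable_fun _ _ TK R setT (p i).
    by move=> _ D mD; rewrite setTI; exact: g_sigma_preimage_generator.
  have mZK : @measurable_fun _ _ TK R setT Z'.
    apply: (@measurable_sum _ TK) => i; apply: (@measurable_funM _ TK) => //.
    apply: (@measurable_funM _ TK) => //.
    by apply: (measurableT_comp measurable_probit); exact: mpK.
  have mqK : @measurable_fun _ _ TK R setT q.
    by move=> _ D mD; rewrite setTI; exact: qm.
  have mPK : @measurable_fun _ _ TK R setT (fun w => Phi (Z' w / Num.sqrt (1 - v))).
    apply: (measurableT_comp measurable_Phi).
    exact: (@measurable_funM _ TK).
  have muK := @measurable_funB _ TK _ _ _ _ mqK mPK.
  by move=> D mD; have := muK measurableT D mD; rewrite setTI.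
- move=> C GC; have mC := Gm _ GC.
  rewrite qeq// integral_target_event//.
  rewrite (gaussian_conditional hX mB ZV ZS v1 (Gsub _ GC)).
  have mE (f : T -> R) : measurable_fun setT f ->
      measurable_fun C (fun w => (Phi (f w / Num.sqrt (1 - v)))%:E).
    move=> mf; apply/measurable_EFinP/measurable_funTS.
    by have [] := bounded_measurable_Phi (mq _ mf).
  apply: ae_eq_integral => //; [exact: mE|exact: mE|].
  by apply: filterS ZZ' => w -> _.
Qed.

End Aggregation.

(** * Extremization and the convex hull *)

Section ConvHull.
Context {R : realType}.

(** A hull on the line is an interval. In this form leaving it becomes a measurable event, and
    strict inequalities can be read off through [Phi]. *)
Lemma conv_hullNP (N : nat) (p : 'I_N -> R) (x : R) :
  ~ conv_hull p x <-> (forall i, p i < x) \/ (forall i, x < p i).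
Proof.
(* A convex combination of positive numbers is not zero; it is applied to the distances from x to
   the points. *)
have weights0 (w g : 'I_N -> R) : (forall i, 0 <= w i) -> \sum_(i < N) w i = 1 ->
    (forall i, 0 < g i) -> \sum_(i < N) w i * g i <> 0.
  move=> w0 w1 g0 wg; have w00 i : w i = 0.
    have /(_ i isT) /eqP := psumr_eq0P (fun i _ => mulr_ge0 (w0 i) (ltW (g0 i))) wg.
    by rewrite mulf_eq0 (gt_eqF (g0 i)) orbF => /eqP.
  move: w1; rewrite big1 => [/eqP|i _]; last exact: w00.
  by rewrite eq_sym oner_eq0.
split=> [nx|[h|h] [w [w0 w1 xE]]].
- have [|/existsNP[i /negP]] := pselect (forall i, p i < x); first by left.
  rewrite -leNgt => xi.
  have [|/existsNP[j /negP]] := pselect (forall i, x < p i); first by right.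
  rewrite -leNgt => jx; exfalso; apply: nx.
  (* Barycentric coordinate of x between p j and p i. If these coincide, the quotient is 0 by
     convention, and full weight at i is used instead. *)
  pose t := (x - p j) / (p i - p j).
  have t0 : 0 <= t by rewrite divr_ge0// subr_ge0// (le_trans jx).
  have [ji|ij] := eqVneq (p i) (p j).
    exists (fun k => (k == i)%:R); split.
    + by move=> k; rewrite ler0n.
    + by rewrite (bigD1 i)//= eqxx big1 ?addr0// => k /negbTE ->.
    + rewrite (bigD1 i)//= eqxx mul1r big1 ?addr0 => [|k /negbTE ->]; last by rewrite mul0r.
      by apply/eqP; rewrite eq_le xi ji jx.
  have ij0 : 0 < p i - p j by rewrite subr_gt0 lt_neqAle eq_sym ij (le_trans jx).
  have t1 : t <= 1 by rewrite ler_pdivrMr// mul1r lerD2r.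
  have pick (k : 'I_N) (f : 'I_N -> R) : \sum_l (l == k)%:R * f l = f k.
    rewrite (bigD1 k)//= eqxx mul1r big1 ?addr0// => l /negbTE ->.
    by rewrite mul0r.
  exists (fun k => (k == i)%:R * t + (k == j)%:R * (1 - t)); split.
  + by move=> k; rewrite addr_ge0// mulr_ge0// subr_ge0.
  + by rewrite big_split/= (pick i (fun=> t)) (pick j (fun=> 1 - t)) addrC subrK.
  + rewrite (eq_bigr (fun k => (k == i)%:R * (t * p k) + (k == j)%:R * ((1 - t) * p k))).
      rewrite big_split/= (pick i (fun k => t * p k)) (pick j (fun k => (1 - t) * p k)).
      rewrite (_ : _ + _ = t * (p i - p j) + p j); last by ring.
      by rewrite divfK ?gt_eqF// subrK.
    by move=> k _; ring.
- apply: (weights0 w (fun i => x - p i)) => // [i|]; first by rewrite subr_gt0.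
  under eq_bigr do rewrite mulrBr.
  by rewrite sumrB -mulr_suml w1 mul1r -xE subrr.
- apply: (weights0 w (fun i => p i - x)) => // [i|]; first by rewrite subr_gt0.
  under eq_bigr do rewrite mulrBr.
  by rewrite sumrB -mulr_suml w1 mul1r -xE subrr.
Qed.
End ConvHull.

(** Comparing squares, gamma^2 (1 - delta) - (1 - delta gamma) = (gamma - 1) (gamma + 1 - delta
    gamma), where both factors are positive. *)
Lemma cs_ratio_gt1 (R : realType) (gamma delta : R) :
  1 < gamma -> 0 < delta < 1 -> delta * gamma < 1 ->
  1 < gamma * Num.sqrt (1 - delta) / Num.sqrt (1 - delta * gamma).
Proof.
move=> g1 /andP[d0 d1] dg.
have b0 : 0 < Num.sqrt (1 - delta * gamma) by rewrite sqrtr_gt0 subr_gt0.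
rewrite ltr_pdivlMr// mul1r -[ltLHS]gtr0_norm// -[ltRHS]ger0_norm; last first.
  by rewrite mulr_ge0// (le_trans _ (ltW g1)).
rewrite -ltr_sqr ?nnegrE ?normr_ge0// !real_normK ?num_real//.
rewrite exprMn !sqr_sqrtr ?subr_ge0 ?ltW//.
rewrite -subr_gt0 (_ : _ - _ = (gamma - 1) * (gamma + 1 - delta * gamma)); last by ring.
by rewrite mulr_gt0 ?subr_gt0//; lra.
Qed.

Section GaussianSpaceAe.
Context {d : measure_display} {T : measurableType d} {R : realType}.
Variable P : probability T R.
Variable X : set (measurableTypeR R) -> {RV P >-> R}.
Hypothesis hX : gaussian_information_model X.

(** Applied to M, this discards the event where the average-probit aggregator is 1/2: there the
    quotient of probits is 0 by convention and nothing extremizes. *)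
Lemma gaussian_space_neq0 (f : T -> R) : gaussian_space X f -> 0 < inner P f f ->
  \forall w \ae P, f w != 0.
Proof.
move=> hf f0.
have s0 : 0 < Num.sqrt (inner P f f) by rewrite sqrtr_gt0.
have m0 : measurable [set 0 : R] by exact: measurable_set1.
have law := gaussian_space_normal hX hf (esym (sqr_sqrtr (ltW f0))) s0 m0.
exists (f @^-1` [set 0]); split.
- by rewrite -[_ @^-1` _]setTI; exact: (gaussian_space_measurable hf).
- rewrite [LHS]law.
  apply: ((null_content_dominatesP _ _).1 (normal_prob_dominates 0 _)) => //.
  exact: lebesgue_measure_set1.
- by move=> w /= /negP; rewrite negbK => /eqP.
Qed.

(** Serves the case lambda = 1, where the differences Y_i - Y_j have variance 0. *)
Lemma gaussian_space_eq0 (f : T -> R) : gaussian_space X f -> inner P f f = 0 ->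
  \forall w \ae P, f w = 0.
Proof.
move=> hf f0.
have i2 := gaussian_space_mul_integrable hX hf hf.
have : (\int[P]_w `|(f w * f w)%:E| = 0)%E.
  rewrite -(@fineK _ (\int[P]_w `|(f w * f w)%:E|)%E).
    congr EFin; rewrite -[RHS]f0 /inner /Rintegral; congr fine.
    by apply: eq_integral => w _; rewrite /= ger0_norm// -expr2 sqr_ge0.
  apply: integrable_fin_num => //.
  by have := integrable_norm i2; apply: eq_integrable.
move/ae_eq_integral_abs => /(_ measurableT) [|N [mN N0 sub]].
  exact: measurable_int i2.
exists N; split => // w /= nw; apply: sub => /= /(_ I) [] /eqP.
by rewrite mulf_eq0 orbb => /eqP.
Qed.

End GaussianSpaceAe.

Section PositiveProbability.
Context {d : measure_display} {T : measurableType d} {R : realType}.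
Variable P : probability T R.
Variable X : set (measurableTypeR R) -> {RV P >-> R}.
Hypothesis hX : gaussian_information_model X.

Lemma measurable_set_lt (f g : T -> R) : measurable_fun setT f ->
  measurable_fun setT g -> measurable [set w | f w < g w].
Proof.
move=> mf mg.
have := measurable_funB mf mg measurableT (measurable_itv `]-oo, 0[).
rewrite setTI; congr measurable; apply/seteqP; split => w /=; by rewrite in_itv/= subr_lt0.
Qed.

(** For some k the event that all |V_i| are at most k has positive probability, as these events
    exhaust the space. It is independent of the event U > k / e, which has positive probability
    because U is a nondegenerate normal variable. *)
Lemma orthogonal_dominated_gt0 (n : nat) (U : T -> R) (V : 'I_n -> T -> R) (e : R) :
  gaussian_space X U -> (forall i, gaussian_space X (V i)) ->
  (forall i, inner P U (V i) = 0) -> 0 < inner P U U -> 0 < e ->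
  (0 < P [set w | forall i, (`|V i w| < e * U w)%R])%E.
Proof.
move=> hU hV UV U0 e0.
have mU := gaussian_space_measurable hU.
have mV i := gaussian_space_measurable (hV i).
pose F (k : nat) := [set w | forall i, `|V i w| <= k%:R].
have sF k : g_sigma_preimage V (F k).
  pose K := \big[setU/set0]_(i < n) preimage_set_system setT (V i) measurable.
  pose TK := g_sigma_algebraType K.
  have -> : F k = \bigcap_(i in [set: 'I_n]) (V i @^-1` `[- k%:R, k%:R]%classic).
    apply/seteqP; split => w /= h i; first by move=> _; rewrite /= in_itv/= -ler_norml.
    by have := h i I; rewrite /= in_itv/= -ler_norml.
  apply: (@fin_bigcap_measurable _ TK) => // i _.
  exact: (g_sigma_preimage_generator (V := V)).
have mF k : measurable (F k) by exact: (g_sigma_preimage_measurable mV (sF k)).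
have [k Pk] : exists k, P (F k) != 0%E.
  apply/not_existsP => h.
  have : P.-negligible (\bigcup_k F k).
    apply: negligible_bigcup => k; exists (F k); split => //.
    by have /negP := h k; rewrite negbK => /eqP.
  have -> : \bigcup_k F k = setT.
    apply/seteqP; split => // w _.
    exists (Num.trunc (\sum_i `|V i w|)).+1 => // i.
    rewrite (le_trans _ (ltW (truncnS_gt _)))// (bigD1 i)//= lerDl.
    by rewrite sumr_ge0.
  move=> [A [mA A0 sA]].
  have : (P setT <= P A)%E by apply: le_measure; rewrite ?inE.
  by rewrite A0 probability_setT lee_fin ler10.
pose D := `]k%:R / e, +oo[%classic : set R.
have mD : measurable D by exact: measurable_itv.
have mUD : measurable (U @^-1` D) by rewrite -[_ @^-1` _]setTI; exact: mU.
have s0 : 0 < Num.sqrt (inner P U U) by rewrite sqrtr_gt0.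
have PD : (0 < P (U @^-1` D))%E.
  have := gaussian_space_normal hX hU (esym (sqr_sqrtr (ltW U0))) s0 mD.
  move=> ->; apply: (@lt_le_trans _ _ (normal_prob 0 (Num.sqrt (inner P U U))
    `]k%:R / e, k%:R / e + 1]%classic)).
    by apply: normal_prob_itv_gt0; [rewrite gt_eqF|rewrite ltrDl].
  apply: le_measure; rewrite ?inE//.
  by move=> x /=; rewrite /D /= !in_itv/= andbT => /andP[].
apply: (@lt_le_trans _ _ (P (F k `&` U @^-1` D))).
  rewrite (orthogonal_independent hX hU hV UV (sF k))// mule_gt0//.
  by rewrite lt0e Pk measure_ge0.
apply: le_measure; rewrite ?inE.
- exact: measurableI.
- have -> : [set w | forall i, `|V i w| < e * U w] =
      \bigcap_(i in [set: 'I_n]) [set w | `|V i w| < e * U w].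
    by apply/seteqP; split => w /= h i; [move=> _|]; exact: h.
  apply: fin_bigcap_measurable => // i _; apply: measurable_set_lt.
    exact: measurableT_comp.
  exact: measurable_funM.
- move=> w [Fw]; rewrite /D /= in_itv/= andbT => Dw i.
  by rewrite (le_lt_trans (Fw i))// mulrC -ltr_pdivrMr.
Qed.

End PositiveProbability.

(** * Covariances of the compound symmetric structure *)

Section CompoundSymmetric.
Context {R : realType}.
Variables (N : nat) (delta lambda : R) (B : 'I_N -> set (measurableTypeR R)).
Hypothesis hB : compound_symmetric delta lambda B.
Hypothesis hN : (0 < N)%N.
Hypothesis d0 : 0 < delta.

(** Two distinct sets are required: the structure puts no constraint on lambda when N = 1. *)
Lemma compound_symmetric_lambda : (1 < N)%N -> 0 <= lambda <= 1.
Proof.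
move=> N1; case: hB => mB Bd Bl.
pose i : 'I_N := Ordinal hN; pose j : 'I_N := Ordinal N1.
have ij : i != j by [].
apply/andP; split.
  have : (0 <= lebesgue_measure (B i `&` B j))%E by exact: measure_ge0.
  by rewrite Bl// lee_fin pmulr_lge0.
have : (lebesgue_measure (B i `&` B j) <= lebesgue_measure (B i))%E.
  apply: le_measure; rewrite ?inE//; last exact: (mB i).1.
  by apply: measurableI; [exact: (mB i).1|exact: (mB j).1].
by rewrite Bl// Bd lee_fin ger_pMl.
Qed.

Lemma cs_denominator_gt0 : 0 < (N%:R - 1) * lambda + 1.
Proof.
have [N1|N1] := ltnP 1 N; last first.
  by rewrite (_ : N = 1%N) ?subrr ?mul0r ?add0r//; apply/eqP; rewrite eqn_leq N1.
have /andP[l0 _] := compound_symmetric_lambda N1.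
by rewrite ltr_wpDl// mulr_ge0// subr_ge0 ler1n.
Qed.

Lemma cs_gamma_gt0 : 0 < cs_gamma N lambda.
Proof. by rewrite /cs_gamma divr_gt0 ?ltr0n// cs_denominator_gt0. Qed.

Lemma cs_gamma_gt1 : (1 < N)%N -> lambda < 1 -> 1 < cs_gamma N lambda.
Proof.
move=> N1 l1; rewrite /cs_gamma ltr_pdivlMr ?cs_denominator_gt0// mul1r.
rewrite -ltrBrDr gtr_pMr// subr_gt0.
by rewrite ltr1n.
Qed.

Context {d : measure_display} {T : measurableType d}.
Variable P : probability T R.
Variable X : set (measurableTypeR R) -> {RV P >-> R}.
Hypothesis hX : gaussian_information_model X.

Lemma cs_inner (i j : 'I_N) :
  inner P (X (B i)) (X (B j)) = if i == j then delta else lambda * delta.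
Proof.
case: hB => mB Bd Bl; apply: EFin_inj; rewrite (inner_X hX)//.
by case: eqVneq => [->|ij]; rewrite ?setIid ?Bd ?Bl.
Qed.

(** A row sum of the covariance matrix, with one entry delta and N - 1 entries lambda delta. That it
    does not depend on j is what makes a multiple of the mean the projection. *)
Lemma cs_inner_sum (c : R) (j : 'I_N) :
  inner P (fun w => \sum_(i < N) c * X (B i) w) (X (B j)) =
  c * (delta * ((N%:R - 1) * lambda + 1)).
Proof.
case: (hB) => mB _ _; rewrite innerC.
rewrite (inner_sumr hX); [|exact: gaussian_space_X|by move=> i; exact: gaussian_space_X].
rewrite -mulr_sumr (bigD1 j)//= cs_inner eqxx.
rewrite (eq_bigr (fun=> lambda * delta)); last first.
  by move=> i ij; rewrite cs_inner eq_sym (negbTE ij).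
rewrite sumr_const; congr (_ * _).
have -> : #|[pred i | i != j]| = N.-1.
  by have := cardC1 j; rewrite card_ord => <-; apply: eq_card => i; rewrite !inE.
by rewrite -(mulr_natr (lambda * delta)) -subn1 natrB//; ring.
Qed.

End CompoundSymmetric.

Unset Implicit Arguments.
Set Strict Implicit.
Set Printing Implicit Defensive.

Theorem proposition5p1 (R : realType) (d : measure_display)
    (T : measurableType d) (P : probability T R)
    (X : set (measurableTypeR R) -> {RV P >-> R})
    (N : nat) (delta lambda : R) (B : 'I_N -> set (measurableTypeR R))
    (p : 'I_N -> T -> R) (pcs : T -> R)
    (hX : gaussian_information_model X)
    (hN : (0 < N)%N)
    (hB : compound_symmetric delta lambda B)
    (hdelta : 0 < delta < 1)
    (hgamma : delta * cs_gamma N lambda < 1)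
    (hp : forall i, is_forecast X (B i) (p i))
    (hpcs : is_revealed_aggregator X p pcs) :
  let gamma := cs_gamma N lambda in
  let pprobit := fun w => average_probit (fun i => p i w) in
  [/\ \forall w \ae P, probit_ratio (pcs w) (pprobit w)
        = gamma * Num.sqrt (1 - delta) / Num.sqrt (1 - delta * gamma),
      \forall w \ae P, (exists i j, i != j /\ p i w <> p j w) ->
        extremizes (pcs w) (pprobit w)
    & (1 < N)%N -> lambda < 1 ->
        (0 < P [set w | ~ conv_hull (fun i => p i w) (pcs w)])%E ].
Proof.
move=> gamma pprobit.
have /andP[d0 d1] := hdelta; have [mB Bd Bl] := hB.
have g0 : 0 < gamma by exact: cs_gamma_gt0 hB hN d0.
have den0 := cs_denominator_gt0 hB hN d0.
have N0 : N%:R != 0 :> R by rewrite pnatr_eq0 -lt0n.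
pose a := Num.sqrt (1 - delta); pose b := Num.sqrt (1 - delta * gamma).
have a0 : 0 < a by rewrite sqrtr_gt0 subr_gt0.
have b0 : 0 < b by rewrite sqrtr_gt0 subr_gt0.
pose Y i : T -> R := X (B i).
have hY i : gaussian_space X (Y i) by exact: gaussian_space_X.
pose M w := \sum_(i < N) N%:R^-1 * Y i w.
have hM : gaussian_space X M by exact: gaussian_space_sum.
have MY j : inner P M (Y j) = delta / gamma.
  rewrite (cs_inner_sum hB hN hX) /gamma /cs_gamma invf_div.
  by rewrite mulrC mulrA.
have MM : inner P M M = delta / gamma.
  rewrite {2}/M (inner_sumr hX)// (eq_bigr (fun=> N%:R^-1 * (delta / gamma))).
    by rewrite sumr_const card_ord -[LHS]mulr_natr mulrAC mulVf// mul1r.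
  by move=> i _; rewrite MY.
have MM0 : 0 < inner P M M by rewrite MM divr_gt0.
have SY j : inner P (X unit_S) (Y j) = delta.
  apply: EFin_inj; rewrite (inner_X hX)//; last exact: borel_unit_S.
  by rewrite setIidr ?Bd//; case: (mB j).
(* The coefficient gamma / N is 1 / ((N - 1) lambda + 1), the one for which Cov(Z, Y_j) equals
   Cov(X_S, Y_j) = delta. *)
pose Z w := \sum_(i < N) (gamma / N%:R) * Y i w.
have ZM w : Z w = gamma * M w.
  by rewrite /Z /M mulr_sumr; apply: eq_bigr => i _; rewrite mulrA.
have hZ : gaussian_space X Z by exact: gaussian_space_sum.
have ZY j : inner P Z (Y j) = delta.
  rewrite (_ : Z = fun w => gamma * M w); last exact/funext.
  by rewrite innerC (innerZr hX)// innerC MY mulrC divfK// gt_eqF.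
have hS : gaussian_space X (X unit_S) by apply: gaussian_space_X; exact: borel_unit_S.
have SZ : inner P (X unit_S) Z = delta * gamma.
  rewrite (inner_sumr hX)// (eq_bigr (fun=> (gamma / N%:R) * delta)).
    by rewrite sumr_const card_ord -[LHS]mulr_natr; field.
  by move=> i _; rewrite SY.
have pYi i : \forall w \ae P, p i w = Phi (Y i w / a).
  exact: (forecast_ae hX (mB i) (Bd i) d1 (hp i)).
have pY : \forall w \ae P, forall i, p i w = Phi (Y i w / a).
  exact: filter_forall.
have qZ : \forall w \ae P, pcs w = Phi (gamma * M w / b).
  have h : \forall w \ae P, pcs w = Phi (Z w / b).
    apply: (revealed_ae hX mB _ SZ hgamma _ hp _ hpcs (k := a)).
    - by move=> j; rewrite ZY SY.
    - by rewrite gt_eqF.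
    - exact: pYi.
  by apply: filterS h => w ->; rewrite ZM.
have pM w : (forall i, p i w = Phi (Y i w / a)) -> pprobit w = Phi (M w / a).
  move=> h; rewrite /pprobit /average_probit; congr Phi.
  rewrite mulr_sumr /M mulr_suml; apply: eq_bigr => i _.
  by rewrite h PhiK mulrA.
have Mn0 := gaussian_space_neq0 hX hM MM0.
(* The two probits are gamma M / b and M / a, both multiples of M, so their quotient is this
   constant. *)
pose r := gamma * a / b.
have qr (m : R) : gamma * m / b = r * (m / a).
  by rewrite /r; field; rewrite !gt_eqF.
split.
- apply: filterS3 pY qZ Mn0 => w /pM hpr -> m0.
  rewrite /probit_ratio hpr !PhiK qr mulfK//.
  by rewrite mulf_neq0// invr_eq0 gt_eqF.
- have [N1|N1] := ltnP 1 N; last first.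
    apply: aeW => w [i [j [/eqP ij _]]]; exfalso; apply: ij; apply/val_inj.
    have := leq_trans (ltn_ord i) N1; have := leq_trans (ltn_ord j) N1.
    by rewrite /= !ltnS !leqn0 => /eqP -> /eqP ->.
  have /andP[l0 l1] := compound_symmetric_lambda hB hN d0 N1.
  have [l1'|l1'] := ltP lambda 1.
    have r1 : 1 < r by apply: cs_ratio_gt1 => //; exact: cs_gamma_gt1 hB hN d0 N1 l1'.
    apply: filterS3 pY qZ Mn0 => w /pM hpr -> m0 _.
    rewrite /extremizes hpr qr; set x := M w / a.
    have x0 : x != 0 by rewrite mulf_neq0// invr_eq0 gt_eqF.
    rewrite !gtr0_norm ?Phi_gt0 ?subr_gt0 ?Phi_lt1// ltrD2l ltrN2 !Phi_ltE.
    split => hx.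
      have xn : x < 0 by rewrite lt_neqAle x0 -Phi_le_half.
      by rewrite -subr_gt0; nra.
    have xp : 0 < x by rewrite lt_neqAle eq_sym x0 -Phi_ge_half.
    by rewrite -subr_gt0; nra.
  (* Here r = 1 and there is no extremizing, but Y_i - Y_j has variance 2 delta - 2 lambda delta =
     0, so almost surely no two forecasts differ. *)
  have {l1 l1'}l1 : lambda = 1 by apply/eqP; rewrite eq_le l1 l1'.
  have YY : \forall w \ae P, forall i j, Y i w + (-1) * Y j w = 0.
    apply: filter_forall => i; apply: filter_forall => j.
    have hn : gaussian_space X (fun w => (-1) * Y j w) by exact: gaussian_spaceZ.
    have hij : gaussian_space X (fun w => Y i w + (-1) * Y j w) by exact: gaussian_spaceD.
    apply: (gaussian_space_eq0 hX) => //.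
    rewrite (innerDr hX)// (innerZr hX)// innerC (innerDr hX)// (innerZr hX)//.
    rewrite [X in _ + _ * X]innerC (innerDr hX)// (innerZr hX)//.
    rewrite /Y !(cs_inner hB hX) !eqxx l1 mul1r !if_same.
    by ring.
  apply: filterS2 pY YY => w h1 h2 [i [j [_]]].
  by rewrite !h1 (_ : Y i w = Y j w)//; have := h2 i j; lra.
- move=> N1 l1.
  have r1 : 1 < r by apply: cs_ratio_gt1 => //; exact: cs_gamma_gt1 hB hN d0 N1 l1.
  pose V i w := Y i w + (-1) * M w.
  have hnM : gaussian_space X (fun w => (-1) * M w) by exact: gaussian_spaceZ.
  have hV i : gaussian_space X (V i) by exact: gaussian_spaceD.
  have MV i : inner P M (V i) = 0.
    by rewrite (innerDr hX)// (innerZr hX)// MY MM; ring.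
  (* The threshold r - 1 is chosen so that |Y_i - M| < (r - 1) M gives Y_i < r M, which after
     division by a compares the probits of p_i and of the aggregator. *)
  have e0 : 0 < r - 1 by rewrite subr_gt0.
  have pos := orthogonal_dominated_gt0 hX hM hV MV MM0 e0.
  have mp i : measurable_fun setT (p i).
    by have [_ /measurable_int/measurable_EFinP + _] := hp i.
  have mq : measurable_fun setT pcs.
    by have [_ /measurable_int/measurable_EFinP + _] := hpcs.
  set G := [set w | _] in pos.
  set NC := [set w | _].
  have mNC : measurable NC.
    have -> : NC = (\bigcap_(i in [set: 'I_N]) [set w | p i w < pcs w]) `|`
        (\bigcap_(i in [set: 'I_N]) [set w | pcs w < p i w]).
      apply/seteqP; split => w.
        by move/conv_hullNP => [h|h]; [left|right] => i _; exact: h.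
      by move=> h; apply/conv_hullNP; case: h => h; [left|right] => i; exact: h.
    by apply: measurableU; apply: fin_bigcap_measurable => // i _; exact: measurable_set_lt.
  have : \forall w \ae P, G w -> NC w.
    apply: filterS2 pY qZ => w h1 h2 Gw; apply/conv_hullNP; left => i.
    rewrite h1 h2 qr Phi_ltE mulrA ltr_pM2r ?invr_gt0//.
    have := Gw i; rewrite ltr_norml /V => /andP[_].
    by move: (Y i w) (M w) => y m; lra.
  (* G is contained in NC only up to the null set A, since the forecasts and the aggregator have
     their explicit forms almost surely. *)
  move=> [A [mA A0 sA]].
  apply: (lt_le_trans pos).
  have mG : measurable G.
    have -> : G = \bigcap_(i in [set: 'I_N]) [set w | `|V i w| < (r - 1) * M w].
      by apply/seteqP; split => w /= h i; [move=> _|]; exact: h.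
    apply: fin_bigcap_measurable => // i _; apply: measurable_set_lt.
      by apply: measurableT_comp => //; exact: gaussian_space_measurable (hV i).
    by apply: measurable_funM => //; exact: gaussian_space_measurable hM.
  apply: (@le_trans _ _ (P (NC `|` A))).
    apply: le_measure; rewrite ?inE//; first exact: measurableU.
    move=> w Gw; have [?|n] := pselect (NC w); first by left.
    by right; apply: sA => /= /(_ Gw).
  apply: (@le_trans _ _ (P NC + P A)%E); first exact: measureU2.
  by rewrite A0 adde0.
Qed.
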